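(* Two fanning curves $\ell(t)$ and $\tilde\ell(t)$ of Lagrangian subspaces of $(\mathbb{R}^{2n},\omega)$ are congruent (under the linear symplectic group) if and only if they have the same signature $k$ $(0\le k\le n)$ and the Schwarzians of any two of their Lagrangian normal frames are conjugate by a constant $n\times n$ matrix in $O(n-k,k)$. That is, if $\mathcal{A}(t)$ and $\mathcal{B}(t)$ are any Lagrangian normal frames spanning $\ell(t)$ and $\tilde\ell(t)$ respectively, then the curves are congruent if and only if they have the same signature $k$ and there is a constant $X\in O(n-k,k)$ with $\{\mathcal{B}(t),t\}=X^{-1}\{\mathcal{A}(t),t\}X$ for all $t$.
   Context: $\mathbb{R}^{2n}$ carries the standard symplectic form $\omega(\mathbf{v},\mathbf{w})=\mathbf{v}^T\mathbf{J}\mathbf{w}$, $\mathbf{J}=\begin{pmatrix}O&-I\\ I&O\end{pmatrix}$. A Lagrangian frame is a $2n\times n$ real matrix $\mathcal{A}$ of rank $n$ with $\mathcal{A}^T\mathbf{J}\mathcal{A}=O$. A smooth curve $\mathcal{A}(t)$, $t\in\mathbb{R}$, of $2n\times n$ matrices is a fanning frame if the juxtaposed matrix $(\mathcal{A}(t)|\dot{\mathcal{A}}(t))$ is invertible for all $t$; a fanning curve of Lagrangian subspaces is the column span $\ell(t)$ of a fanning frame consisting of Lagrangian frames. Two such curves are congruent if $\tilde\ell(t)=\mathbf{S}\ell(t)$ for all $t$ for some linear symplectic transformation $\mathbf{S}$ ($\mathbf{S}^T\mathbf{J}\mathbf{S}=\mathbf{J}$). The Wronskian of a curve of Lagrangian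 frames is $W(t)=-\mathcal{A}(t)^T\mathbf{J}\dot{\mathcal{A}}(t)$; it is symmetric, and it is invertible for all $t$ when the curve is fanning. The signature of a fanning curve of Lagrangian subspaces is the index (number of negative eigenvalues) of the Wronskian of any curve of Lagrangian frames spanning it (it is independent of the frame and of $t$). For a fanning frame there are unique smooth curves of $n\times n$ matrices $P(t),Q(t)$ with $\ddot{\mathcal{A}}+\dot{\mathcal{A}}P(t)+\mathcal{A}Q(t)=O$; the Schwarzian is $\{\mathcal{A}(t),t\}=2Q(t)-\tfrac12P(t)^2-\dot P(t)$. $I_{n,k}$ is the diagonal $n\times n$ matrix whose first $k$ diagonal entries are $-1$ and whose remaining diagonal entries are $1$; $O(n-k,k)=\{X: X^TI_{n,k}X=I_{n,k}\}$. A fanning Lagrangian frame $\mathcal{A}(t)$ is a Lagrangian normal frame if for all $t$ the columns of $\ddot{\mathcal{A}}(t)$ are linear combinations of those of $\mathcal{A}(t)$ and its Wronskian is $I_{n,k}$ for some $0\le k\le n$. *)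

(* Defs.v *)
From HB Require Import structures.
From mathcomp Require Import all_boot all_order all_algebra.
From mathcomp Require Import all_classical all_reals all_analysis.
From mathcomp Require polyrcf.

Set Implicit Arguments.
Unset Strict Implicit.
Unset Printing Implicit Defensive.

Import Order.TTheory GRing.Theory Num.Theory.
Import numFieldNormedType.Exports.

Local Open Scope ring_scope.

Definition sympl_mx (R : realType) (n : nat) : 'M[R]_(n + n) :=
  block_mx 0 (- 1%:M) 1%:M 0.

Definition symplectic (R : realType) (n : nat) (S : 'M[R]_(n + n)) : Prop :=
  S^T *m sympl_mx R n *m S = sympl_mx R n.

Definition lagrangian_frame (R : realType) (n : nat)
    (A : 'M[R]_(n + n, n)) : Prop :=
  \rank A = n /\ A^T *m sympl_mx R n *m A = 0.

Definition smooth (R : realType) (m p : nat) (A : R -> 'M[R]_(m, p)) : Prop :=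
  forall (j : nat) (t : R), derivable (derive1n j A) t 1.

Definition fanning_frame (R : realType) (n : nat)
    (A : R -> 'M[R]_(n + n, n)) : Prop :=
  smooth A /\ forall t, row_mx (A t) (derive1 A t) \in unitmx.

Definition colspan (R : realType) (m p : nat) (A : 'M[R]_(m, p)) :
    {vspace 'cV[R]_m} :=
  <<[seq col j A | j : 'I_p]>>%VS.

Definition spans (R : realType) (n : nat) (A : R -> 'M[R]_(n + n, n))
    (l : R -> {vspace 'cV[R]_(n + n)}) : Prop :=
  forall t, l t = colspan (A t).

Definition fanning_lagrangian_curve (R : realType) (n : nat)
    (l : R -> {vspace 'cV[R]_(n + n)}) : Prop :=
  exists A : R -> 'M[R]_(n + n, n),
    [/\ fanning_frame A, forall t, lagrangian_frame (A t) & spans A l].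

Definition congruent (R : realType) (n : nat)
    (l l' : R -> {vspace 'cV[R]_(n + n)}) : Prop :=
  exists2 S : 'M[R]_(n + n), symplectic S &
    forall t, l' t = (linfun (mulmx S : 'cV[R]_(n + n) -> 'cV[R]_(n + n))
                        @: l t)%VS.

Definition wronskian (R : realType) (n : nat) (A : R -> 'M[R]_(n + n, n))
    (t : R) : 'M[R]_n :=
  - ((A t)^T *m sympl_mx R n *m derive1 A t).

(* Eigenvalues are counted with algebraic multiplicity. *)
Definition neg_index (R : realType) (n : nat) (W : 'M[R]_n) : nat :=
  (\sum_(x <- polyrcf.rootsR (char_poly W) | (x < 0)%R) mup x (char_poly W))%N.

Lemma neg_index_split (R : realType) (n : nat) (W : 'M[R]_n) (s : seq R) :
  char_poly W = \prod_(x <- s) ('X - x%:P) ->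
  neg_index W = count (fun x => x < 0) s.
Proof.
move=> eW; have W0 : char_poly W != 0 by exact/monic_neq0/char_poly_monic.
have mem x : (x \in polyrcf.rootsR (char_poly W)) = (x \in s).
  by rewrite -polyrcf.roots_on_rootsR//= eW root_prod_XsubC.
have uq : uniq (polyrcf.rootsR (char_poly W)) by exact: polyrcf.uniq_roots.
rewrite /neg_index eW (eq_bigr (fun x => count_mem x s)); last first.
  by move=> x _; rewrite mu_prod_XsubC.
rewrite -eW (perm_big (undup s)); last first.
  by apply: uniq_perm => // [|x]; rewrite ?undup_uniq// mem_undup mem.
rewrite -sum1_count -[RHS]big_undup_iterop_count/=.
by apply: eq_bigr => x _; rewrite Monoid.iteropE iter_addn_0 mul1n.
Qed.

Definition has_signature (R : realType) (n : nat)
    (l : R -> {vspace 'cV[R]_(n + n)}) (k : nat) : Prop :=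
  forall A : R -> 'M[R]_(n + n, n),
    smooth A -> (forall t, lagrangian_frame (A t)) -> spans A l ->
    forall t, neg_index (wronskian A t) = k.

(* For a fanning frame A the equation A'' + A' P + A Q = 0 reads
   (A | A') (Q / P) = - A'' with (A | A') invertible, which determines the
   block column (Q / P); see frame_coefP. *)
Definition frame_coef (R : realType) (n : nat) (A : R -> 'M[R]_(n + n, n))
    (t : R) : 'M[R]_(n + n, n) :=
  - (invmx (row_mx (A t) (derive1 A t)) *m derive1n 2 A t).

Definition frameQ (R : realType) (n : nat) (A : R -> 'M[R]_(n + n, n))
    (t : R) : 'M[R]_n := usubmx (frame_coef A t).

Definition frameP (R : realType) (n : nat) (A : R -> 'M[R]_(n + n, n))
    (t : R) : 'M[R]_n := dsubmx (frame_coef A t).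

Lemma frame_coefP (R : realType) (n : nat) (A : R -> 'M[R]_(n + n, n)) (t : R)
    (P Q : 'M[R]_n) :
  fanning_frame A ->
  derive1n 2 A t + derive1 A t *m P + A t *m Q = 0 <->
  P = frameP A t /\ Q = frameQ A t.
Proof.
move=> [_ /(_ t) uA]; have -> : derive1n 2 A t + derive1 A t *m P + A t *m Q =
    derive1n 2 A t + row_mx (A t) (derive1 A t) *m col_mx Q P.
  by rewrite mul_row_col -addrA (addrC (derive1 A t *m P)).
split=> [/eqP|[-> ->]]; last first.
  by rewrite vsubmxK mulmxN mulKVmx// subrr.
rewrite addrC addr_eq0 => /eqP e.
have cE : col_mx Q P = frame_coef A t by rewrite /frame_coef -mulmxN -e mulKmx.
by rewrite /frameP /frameQ -cE col_mxKu col_mxKd.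
Qed.

Definition schwarzian (R : realType) (n : nat) (A : R -> 'M[R]_(n + n, n))
    (t : R) : 'M[R]_n :=
  2%:R *: frameQ A t - 2%:R^-1 *: (frameP A t *m frameP A t)
  - derive1 (frameP A) t.

Definition Ink (R : realType) (n k : nat) : 'M[R]_n :=
  diag_mx (\row_(i < n) if (i < k)%N then -1 else 1).

(* indefinite_orthogonal k is O(n - k, k). *)
Definition indefinite_orthogonal (R : realType) (n k : nat)
    (X : 'M[R]_n) : Prop :=
  X^T *m Ink R n k *m X = Ink R n k.

Definition lagrangian_normal_frame (R : realType) (n : nat)
    (A : R -> 'M[R]_(n + n, n)) : Prop :=
  [/\ fanning_frame A,
      forall t, lagrangian_frame (A t),
      forall t, (colspan (derive1n 2 A t) <= colspan (A t))%VS &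
      exists2 k : nat, (k <= n)%N & forall t, wronskian A t = Ink R n k].

Definition schwarzians_conjugate (R : realType) (n k : nat)
    (A B : R -> 'M[R]_(n + n, n)) : Prop :=
  exists2 X : 'M[R]_n, indefinite_orthogonal k X &
    forall t, schwarzian B t = invmx X *m schwarzian A t *m X.

(* Main.v *)
Require Import Defs.
From HB Require Import structures.
From mathcomp Require Import all_boot all_order all_algebra.
From mathcomp Require Import all_classical all_reals all_analysis.
From mathcomp Require Import ring lra perm complex.

(** A normal frame satisfies A'' = - A Q with {A, t} = 2 Q. Two normal frames of
    the same curve differ by a constant matrix: if B = A X, comparing second
    derivatives puts A' X' in the span of A, so X' = 0; equality of the
    Wronskians then says that X is in O(n - k, k), and Q_B = X^-1 Q_A X. Since
    symplectic maps preserve normal frames, their Wronskians and their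
    Schwarzians, this settles congruent curves. Conversely, if the Schwarzians are
    conjugate by X, then (A X | A' X) and (B | B') solve the same linear equation
    and have the same constant Gram matrix for the symplectic form, so one is the
    image of the other under a constant symplectic matrix. Normal frames exist:
    take A X with X' = P X / 2, which makes the Wronskian constant, and normalise
    it by Sylvester's theorem. The signature is well defined because a change of
    frame acts on the Wronskian by congruence (law of inertia). *)

Set Implicit Arguments.
Unset Strict Implicit.
Unset Printing Implicit Defensive.

Import Order.TTheory GRing.Theory Num.Theory.
Import numFieldNormedType.Exports.

Local Open Scope classical_set_scope.
Local Open Scope ring_scope.

(** * Entrywise differential calculus for matrix curves *)

Section MatrixDerivatives.
Variable R : realType.

Lemma is_derive1E (V : normedModType R) (f : R -> V) (t : R) df :
  is_derive t (1 : R) f df -> derive1 f t = df.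
Proof. by move=> [_ <-]; rewrite derive1E. Qed.

Lemma derivable_is_derive1 (V : normedModType R) (f : R -> V) (t : R) :
  derivable f t (1 : R) -> is_derive t (1 : R) f (derive1 f t).
Proof. by move=> df; apply: DeriveDef; rewrite ?derive1E. Qed.

Lemma is_derive_mxP m n (M : R -> 'M[R]_(m, n)) (t : R) dM :
  is_derive t (1 : R) M dM <->
  forall i j, is_derive t (1 : R) (fun x => M x i j) (dM i j).
Proof.
split=> [[dfM <-] i j|h].
  apply: DeriveDef; first by move/derivable_mxP: dfM.
  by rewrite derive_mx// mxE.
have dfM : derivable M t 1 by apply/derivable_mxP => i j; case: (h i j).
apply: DeriveDef => //; rewrite derive_mx//.
by apply/matrixP => i j; rewrite mxE; case: (h i j).
Qed.

Lemma is_derive_bigsum (I : Type) (r : seq I) (F : I -> R -> R) t dF :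
  (forall i, is_derive t (1 : R) (F i) (dF i)) ->
  is_derive t (1 : R) (fun x => \sum_(i <- r) F i x) (\sum_(i <- r) dF i).
Proof.
move=> h; elim: r => [|i r IH].
  by rewrite big_nil (_ : (fun _ => _) = cst 0);
    [exact: is_derive_cst | apply/funext => x; rewrite big_nil].
rewrite big_cons (_ : (fun _ => _) = F i \+ (fun x => \sum_(j <- r) F j x)).
  exact: is_deriveD.
by apply/funext => x; rewrite big_cons.
Qed.

Lemma is_derive_mulr (f g : R -> R) t df dg :
  is_derive t (1 : R) f df -> is_derive t (1 : R) g dg ->
  is_derive t (1 : R) (fun x => f x * g x) (df * g t + f t * dg).
Proof.
move=> hf hg; have := is_deriveM hf hg.
rewrite (_ : f * g = fun x => f x * g x)//.
by move/is_derive_eq; apply; rewrite /GRing.scale/= addrC (mulrC df).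
Qed.

Lemma is_derive_mulmx m n p (A : R -> 'M[R]_(m, n)) (B : R -> 'M[R]_(n, p))
    t dA dB :
  is_derive t (1 : R) A dA -> is_derive t (1 : R) B dB ->
  is_derive t (1 : R) (fun x => A x *m B x) (dA *m B t + A t *m dB).
Proof.
move=> /is_derive_mxP hA /is_derive_mxP hB; apply/is_derive_mxP => i j.
rewrite (_ : (fun _ => _) = fun x => \sum_k A x i k * B x k j); last first.
  by apply/funext => x; rewrite mxE.
by rewrite !mxE -big_split/=; apply: is_derive_bigsum => k; exact: is_derive_mulr.
Qed.

Lemma is_derive_trmx m n (A : R -> 'M[R]_(m, n)) t dA :
  is_derive t (1 : R) A dA -> is_derive t (1 : R) (fun x => (A x)^T) dA^T.
Proof.
move=> /is_derive_mxP hA; apply/is_derive_mxP => i j.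
by rewrite mxE; under eq_fun do rewrite mxE; exact: hA.
Qed.

Lemma is_derive_row_mx m n p (A : R -> 'M[R]_(m, n)) (B : R -> 'M[R]_(m, p))
    t dA dB :
  is_derive t (1 : R) A dA -> is_derive t (1 : R) B dB ->
  is_derive t (1 : R) (fun x => row_mx (A x) (B x)) (row_mx dA dB).
Proof.
move=> /is_derive_mxP hA /is_derive_mxP hB; apply/is_derive_mxP => i j.
by case: (split_ordP j) => k ->; rewrite ?row_mxEl ?row_mxEr;
  under eq_fun do rewrite ?row_mxEl ?row_mxEr.
Qed.

Lemma derive0_cst_mx m n (A : R -> 'M[R]_(m, n)) :
  (forall t : R, is_derive t (1 : R) A 0) -> forall s t, A s = A t.
Proof.
move=> hA s t; apply/matrixP => i j.
apply: (@is_derive_0_is_cst _ (fun x => A x i j)) => x.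
by have /is_derive_mxP/(_ i j) := hA x; rewrite mxE.
Qed.

End MatrixDerivatives.

(** * Smooth matrix curves and the operations that preserve smoothness *)

Section Smoothness.
Variable R : realType.

(** Differentiability of order [j], with the recursion passing to [derive1 f] first. An induction on
    [j] can then use an explicit formula for the first derivative, whereas [derive1n] puts the last
    derivative outermost. [smoothP] relates the two. *)
Fixpoint diffn (V : normedModType R) (j : nat) (f : R -> V) : Prop :=
  if j is j'.+1 then (forall t : R, derivable f t (1 : R)) /\ diffn j' (derive1 f)
  else True.

Lemma diffnS (V : normedModType R) j (f : R -> V) : diffn j.+1 f -> diffn j f.
Proof.
elim: j f => [//|j IH] f [df /IH h]; split=> //.
Qed.

Lemma smoothP m n (A : R -> 'M[R]_(m, n)) :
  smooth A <-> forall j, diffn j A.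
Proof.
split=> [sA j|dA j t].
  elim: j A sA => [//|j IH] A sA; split; first exact: (sA 0).
  by apply: IH => i t; rewrite -derive1Sn; exact: sA.
have {dA} := dA j.+1; elim: j A => [|j IH] A [dA dA']; first exact: dA.
by rewrite derive1Sn; exact: IH.
Qed.

(** The induction step of the closure properties below: a formula for the derivative is given, and
    its own regularity is left to the induction hypothesis. *)
Lemma diffn_is_derive (V : normedModType R) j (f df : R -> V) :
  (forall t : R, is_derive t (1 : R) f (df t)) -> diffn j df -> diffn j.+1 f.
Proof.
move=> h hj; split=> [t|]; first by case: (h t).
by rewrite (_ : derive1 f = df)//; apply/funext => t; exact: is_derive1E.
Qed.

Lemma diffn_derive (V : normedModType R) j (f : R -> V) :
  diffn j.+1 f -> forall t : R, is_derive t (1 : R) f (derive1 f t).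
Proof. by move=> [h _] t; exact: derivable_is_derive1. Qed.

Lemma diffn_cst (V : normedModType R) j (v : V) : diffn j (fun _ : R => v).
Proof.
elim: j v => [//|j IH] v; apply: (@diffn_is_derive _ _ _ (fun=> 0)) => //.
Qed.

Lemma diffnD (V : normedModType R) j (f g : R -> V) :
  diffn j f -> diffn j g -> diffn j (fun x => f x + g x).
Proof.
elim: j f g => [//|j IH] f g hf hg.
apply: (@diffn_is_derive _ _ _ (fun x => derive1 f x + derive1 g x)).
  by move=> t; apply: is_deriveD; [exact: diffn_derive hf _
                                  |exact: diffn_derive hg _].
by apply: IH; [case: hf | case: hg].
Qed.

Lemma diffnM j (f g : R -> R) :
  diffn j f -> diffn j g -> diffn j (fun x => f x * g x).
Proof.
elim: j f g => [//|j IH] f g hf hg.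
apply: (@diffn_is_derive _ _ _
    (fun x => derive1 f x * g x + f x * derive1 g x)).
  by move=> t; apply: is_derive_mulr; [exact: diffn_derive hf _
                                      |exact: diffn_derive hg _].
by apply: diffnD; apply: IH; (exact: diffnS || (by case: hf) || (by case: hg)).
Qed.

Lemma diffnV j (f : R -> R) :
  (forall x, f x != 0) -> diffn j f -> diffn j (fun x => (f x)^-1).
Proof.
move=> f0; elim: j => [//|j IH] hf.
(* The derivative of the reciprocal is written with products and reciprocals of [f] only, so that
   [diffnM] and the induction hypothesis apply. *)
apply: (@diffn_is_derive _ _ _
    (fun x => -1 * ((f x)^-1 * ((f x)^-1 * derive1 f x)))).
  move=> t; apply: DeriveDef.
    by apply: derivableV => //; case: (diffn_derive hf t).
  rewrite (@deriveV _ _ f)// -?derive1E; last by case: (diffn_derive hf t).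
  by rewrite /GRing.scale/= mulN1r mulNr expr2 invfM mulrA.
have hV := IH (diffnS hf).
by apply: diffnM; [exact: diffn_cst | apply: diffnM => //; apply: diffnM => //;
  case: hf].
Qed.

Lemma diffn_sum j (I : Type) (r : seq I) (P : pred I) (F : I -> R -> R) :
  (forall i, diffn j (F i)) -> diffn j (fun x => \sum_(i <- r | P i) F i x).
Proof.
move=> h; elim: r => [|i r IH].
  by under eq_fun do rewrite big_nil; exact: diffn_cst.
by under eq_fun do rewrite big_cons; case: (P i) => //; exact: diffnD.
Qed.

Lemma diffn_prod j (I : Type) (r : seq I) (P : pred I) (F : I -> R -> R) :
  (forall i, diffn j (F i)) -> diffn j (fun x => \prod_(i <- r | P i) F i x).
Proof.
move=> h; elim: r => [|i r IH].
  by under eq_fun do rewrite big_nil; exact: diffn_cst.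
by under eq_fun do rewrite big_cons; case: (P i) => //; exact: diffnM.
Qed.

Lemma diffn_mxP j m n (A : R -> 'M[R]_(m, n)) :
  diffn j A <-> forall a b, diffn j (fun x => A x a b).
Proof.
elim: j A => [|j IH] A; first by split.
split=> [hA a b|hA].
  apply: (@diffn_is_derive _ _ _ (fun x => derive1 A x a b)).
    by move=> t; move: a b; apply/is_derive_mxP; exact: diffn_derive hA _.
  by move: a b; apply/IH; case: hA.
apply: (@diffn_is_derive _ _ _
    (fun x => \matrix_(a, b) derive1 (fun y => A y a b) x)).
  move=> t; apply/is_derive_mxP => a b; rewrite mxE.
  exact: diffn_derive (hA a b) t.
by apply/IH => a b; under eq_fun do rewrite mxE; case: (hA a b).
Qed.

Lemma diffn_mulmx j m n p (A : R -> 'M[R]_(m, n)) (B : R -> 'M[R]_(n, p)) :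
  diffn j A -> diffn j B -> diffn j (fun x => A x *m B x).
Proof.
move=> /diffn_mxP hA /diffn_mxP hB; apply/diffn_mxP => a b.
by under eq_fun do rewrite mxE; apply: diffn_sum => k; exact: diffnM.
Qed.

Lemma smooth_is_derive m n (A : R -> 'M[R]_(m, n)) t :
  smooth A -> is_derive t (1 : R) A (derive1 A t).
Proof. by move=> sA; apply: derivable_is_derive1; exact: (sA 0). Qed.

Lemma smooth_derive1 m n (A : R -> 'M[R]_(m, n)) :
  smooth A -> smooth (derive1 A).
Proof. by move=> sA j t; rewrite -derive1Sn; exact: sA. Qed.

Lemma smooth_entryP m n (A : R -> 'M[R]_(m, n)) :
  smooth A <-> forall j a b, diffn j (fun x => A x a b).
Proof.
by split=> [/smoothP h j a b|h]; [move: a b; apply/diffn_mxP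
                                 | apply/smoothP => j; apply/diffn_mxP].
Qed.

Lemma smooth_cst m n (M : 'M[R]_(m, n)) : smooth (fun _ : R => M).
Proof. by apply/smoothP => j; exact: diffn_cst. Qed.

Lemma smooth_mulmx m n p (A : R -> 'M[R]_(m, n)) (B : R -> 'M[R]_(n, p)) :
  smooth A -> smooth B -> smooth (fun x => A x *m B x).
Proof. by move=> /smoothP hA /smoothP hB; apply/smoothP => j; exact: diffn_mulmx. Qed.

Lemma smoothZ m n a (A : R -> 'M[R]_(m, n)) :
  smooth A -> smooth (fun x => a *: A x).
Proof.
move=> /smooth_entryP hA; apply/smooth_entryP => j b c.
by under eq_fun do rewrite mxE; apply: diffnM => //; exact: diffn_cst.
Qed.

Lemma smooth_trmx m n (A : R -> 'M[R]_(m, n)) :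
  smooth A -> smooth (fun x => (A x)^T).
Proof.
move=> /smooth_entryP hA; apply/smooth_entryP => j a b.
by under eq_fun do rewrite mxE; exact: hA.
Qed.

Lemma smooth_row_mx m n p (A : R -> 'M[R]_(m, n)) (B : R -> 'M[R]_(m, p)) :
  smooth A -> smooth B -> smooth (fun x => row_mx (A x) (B x)).
Proof.
move=> /smooth_entryP hA /smooth_entryP hB; apply/smooth_entryP => j a b.
by case: (split_ordP b) => k ->; under eq_fun do rewrite ?row_mxEl ?row_mxEr.
Qed.

Lemma smooth_dsubmx m n p (A : R -> 'M[R]_(m + n, p)) :
  smooth A -> smooth (fun x => dsubmx (A x)).
Proof.
move=> /smooth_entryP hA; apply/smooth_entryP => j a b.
by under eq_fun do rewrite mxE; exact: hA.
Qed.

Lemma diffn_det j n (A : R -> 'M[R]_n) :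
  (forall a b, diffn j (fun x => A x a b)) -> diffn j (fun x => \det (A x)).
Proof.
move=> hA; apply: diffn_sum => s; apply: diffnM; first exact: diffn_cst.
by apply: diffn_prod => i; exact: hA.
Qed.

(** By the adjugate formula each entry of the inverse is a signed minor divided by the determinant,
    and both are polynomials in the entries of [A]. *)
Lemma smooth_invmx n (A : R -> 'M[R]_n) :
  smooth A -> (forall t, A t \in unitmx) -> smooth (fun x => invmx (A x)).
Proof.
move=> /smooth_entryP hA uA; apply/smooth_entryP => j a b.
rewrite (_ : (fun _ => _) =
    fun x => (\det (A x))^-1 * ((-1) ^+ (b + a) * \det (row' b (col' a (A x))))).
  apply: diffnM; first apply: diffnV.
  - by move=> x; rewrite -unitfE; exact: uA.
  - by apply: diffn_det => *; exact: hA.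
  - apply: diffnM; first exact: diffn_cst.
    by apply: diffn_det => c d; under eq_fun do rewrite !mxE; exact: hA.
by apply/funext => x; rewrite /invmx uA !mxE /cofactor.
Qed.

End Smoothness.

(** * Primitives of continuous functions on the whole line *)

Section Primitive.
Variable R : realType.
Local Notation mu := (@lebesgue_measure R).

Lemma is_derive_continuous (f : R -> R) (t df : R) :
  is_derive t (1 : R) f df -> {for t, continuous f}.
Proof. by move=> [h _]; exact/differentiable_continuous/derivable1_diffP. Qed.

Lemma derive_ge0_nondecreasing (f df : R -> R) (a b : R) :
  (forall t, a <= t <= b -> is_derive t (1 : R) f (df t)) ->
  (forall t, a <= t <= b -> 0 <= df t) ->
  forall s t, a <= s -> s <= t -> t <= b -> f s <= f t.
Proof.
move=> hf hdf; apply: ger0_derive1_ndecr.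
- move=> x; rewrite in_itv/= => /andP[/ltW ax /ltW xb].
  by case: (hf x); rewrite ?ax ?xb.
- move=> x; rewrite in_itv/= => /andP[/ltW ax /ltW xb].
  by rewrite (is_derive1E (hf x _)) ?hdf ?ax ?xb.
- apply: continuous_in_subspaceT => x; rewrite inE/= in_itv/= => xab.
  exact: is_derive_continuous (hf x xab).
Qed.

Lemma itv_primitive (f : R -> R) (a x : R) : continuous f -> a < x ->
  is_derive x (1 : R) (fun y => \int[mu]_(t in `[a, y]) f t)%R (f x).
Proof.
move=> cf ax.
(* The right end [x + 1] makes [x] an interior point of the interval of integration. *)
have fi : mu.-integrable [set` Interval (BLeft a) (BRight (x + 1))] (EFin \o f).
  apply: continuous_compact_integrable; first exact: segment_compact.
  exact: continuous_subspaceT.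
have [dF FE] := continuous_FTC1 (ltr_pwDr ltr01 (lexx x)) fi ax (cf x).
by apply: DeriveDef => //; rewrite -derive1E.
Qed.

(** An integral from [a] is a primitive only to the right of [a]. Normalised to vanish at [0], these
    primitives agree wherever two of them are valid, so the base point may vary with the
    argument. *)
Lemma continuous_primitive (f : R -> R) : continuous f ->
  exists F : R -> R, F 0 = 0 /\ forall t, is_derive t (1 : R) F (f t).
Proof.
move=> cf.
pose G a y := (\int[mu]_(t in `[a, y]) f t)%R - (\int[mu]_(t in `[a, 0]) f t)%R.
have dG (a x : R) : a < x -> is_derive x (1 : R) (G a) (f x).
  move=> ax; rewrite -[f x]subr0; apply: (@is_deriveB _ _ _
    (fun y => \int[mu]_(t in `[a, y]) f t)%R (cst _)).
  exact: itv_primitive.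
have G0 a : G a 0 = 0 by rewrite /G subrr.
(* The point [d] lies to the right of both base points and to the left of both [0] and [y]. From [d]
   onwards [G a - G b] has zero derivative, hence it and its opposite are nondecreasing, and its
   values at [0] and [y] coincide. *)
have GG a b y : a < 0 -> b < 0 -> a < y -> b < y -> G a y = G b y.
  move=> a0 b0 ay by_; pose c := Num.max a b; pose d := (c + Num.min 0 y) / 2.
  have cm : c < Num.min 0 y by rewrite gt_max !lt_min a0 ay b0 by_.
  have [cd dm] : c < d /\ d < Num.min 0 y.
    by rewrite /d; split; [rewrite midf_lt|rewrite midf_lt].
  have [ad bd] : a < d /\ b < d.
    by split; apply: le_lt_trans cd; rewrite le_max lexx ?orbT.
  have D (x : R) : d <= x -> is_derive x (1 : R) (G a \- G b) 0.
    move=> dx; rewrite -(subrr (f x)).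
    by apply: is_deriveB; apply: dG; exact: lt_le_trans dx.
  have Z : (G a \- G b) 0 = (G a \- G b) y.
    have le s t : d <= s -> s <= t -> (G a \- G b) s <= (G a \- G b) t /\
        - (G a \- G b) s <= - (G a \- G b) t.
      move=> ds st; split.
        apply: (@derive_ge0_nondecreasing (G a \- G b) (fun=> 0) d t) => //.
        by move=> u /andP[du _]; exact: D.
      apply: (@derive_ge0_nondecreasing (fun x => - (G a \- G b) x)
        (fun=> - 0) d t) => //.
      by move=> u /andP[du _]; apply: is_deriveN; exact: D.
    move: dm; rewrite lt_min => /andP[/ltW d0 /ltW dy].
    have [y0|/ltW y0] := leP 0 y.
      have [h1 h2] := le 0 y d0 y0; apply/le_anti; rewrite h1/=.
      by move: h2; rewrite lerN2.
    have [h1 h2] := le y 0 dy y0; apply/le_anti; rewrite h1/= andbT.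
    by move: h2; rewrite lerN2.
  by move: Z; rewrite /= !G0 subrr => /esym/eqP; rewrite subr_eq0 => /eqP.
(* This base point is below both [0] and [x]. *)
pose k (x : R) := - (`|x| + 1).
have k0 x : k x < 0 by rewrite oppr_lt0 ltr_wpDl.
have kx x : k x < x by rewrite /k ltrNl (le_lt_trans (ler_norm _))// normrN ltrDl.
exists (fun x => G (k x) x); split=> [//|x].
(* The moving base point is frozen: for [y] close to [x], [k x] is still to the left of [y], so it
   may replace [k y]. *)
apply: (near_eq_is_derive _ (dG _ _ (kx x))).
near=> y; apply: GG => //; near: y; exact: lt_nbhsr.
Unshelve. all: by end_near. Qed.

End Primitive.

(** * Sequences whose increments decay geometrically *)

Section GeometricConvergence.
Variable R : realType.

Lemma exists_halfpow_lt (K e : R) : 0 < e -> exists k, K / 2 ^+ k < e.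
Proof.
move=> e0; exists (Num.bound (K / e)).
rewrite ltr_pdivrMr ?exprn_gt0// mulrC -ltr_pdivrMr//.
exact: upper_nthrootP.
Qed.

Lemma halfpow_bound_eq (K x y : R) :
  (forall k, `|x - y| <= K / 2 ^+ k) -> x = y.
Proof.
move=> h; apply/eqP; rewrite -subr_eq0 -normr_le0 leNgt; apply/negP => e0.
by have [k] := exists_halfpow_lt K e0; rewrite ltNge h.
Qed.

(** The intervals of centre [x k] and radius [2 * B / 2 ^+ k] are nested. The supremum of their left
    ends lies in all of them, which gives the limit together with its rate. *)
Lemma geometric_limit (x : nat -> R) (B : R) :
  (forall k, `|x k.+1 - x k| <= B / 2 ^+ k) ->
  exists l, forall k, `|l - x k| <= 2 * B / 2 ^+ k.
Proof.
move=> hx; pose a k := x k - 2 * B / 2 ^+ k; pose b k := x k + 2 * B / 2 ^+ k.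
have half k : 2 * B / 2 ^+ k.+1 = B / 2 ^+ k.
  by rewrite exprS invfM mulrACA divff// mul1r.
have dbl k : 2 * B / 2 ^+ k = B / 2 ^+ k + B / 2 ^+ k.
  by rewrite -mulrA mulrDl mul1r.
have aS k : a k <= a k.+1.
  have := hx k; rewrite /a half dbl ler_norml => /andP[h _].
  by move: (B / _) h => p h; lra.
have bS k : b k.+1 <= b k.
  have := hx k; rewrite /b half dbl ler_norml => /andP[_ h].
  by move: (B / _) h => p h; lra.
have B0 k : 0 <= B / 2 ^+ k by exact: le_trans (hx k).
have ab k : a k <= b k by have := B0 k; rewrite /a /b dbl; lra.
have am m n : (m <= n)%N -> a m <= a n.
  by move=> mn; apply: (homo_leq (@lexx _ _) le_trans).
have bm m n : (m <= n)%N -> b n <= b m.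
  by move=> mn; apply: (@homo_leq R b (fun x y => y <= x)) =>
    // v u w vu vw; exact: le_trans vw vu.
have amb m n : a m <= b n.
  have [mn|/ltnW nm] := leqP m n; first exact: le_trans (am _ _ mn) (ab n).
  exact: le_trans (ab m) (bm _ _ nm).
exists (sup (range a)) => k.
have h1 : a k <= sup (range a).
  by apply: ub_le_sup; [exists (b 0) => _ [m _ <-] | exists k].
have h2 : sup (range a) <= b k.
  by apply: ge_sup; [exists (a 0), 0 | move=> _ [m _ <-]].
by move: h1 h2; rewrite /a /b ler_norml; lra.
Qed.

(** The limit is chosen before the bound [B]. The same limit can thus be used with bounds that come
    from different time intervals. *)
Lemma geometric_limit_uniform (x : nat -> R) :
  (exists B, forall k, `|x k.+1 - x k| <= B / 2 ^+ k) ->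
  exists l, forall B, (forall k, `|x k.+1 - x k| <= B / 2 ^+ k) ->
    forall k, `|l - x k| <= 2 * B / 2 ^+ k.
Proof.
move=> [B0 hB0]; have [l hl] := geometric_limit hB0; exists l => B hB.
have [l' hl'] := geometric_limit hB.
suff -> : l = l' by [].
apply: (@halfpow_bound_eq (2 * B0 + 2 * B)) => k.
rewrite -(subrKA (x k)) mulrDl; apply: le_trans (ler_normD _ _) _.
by apply: lerD => //; rewrite distrC.
Qed.

End GeometricConvergence.

(** * Weighted estimates for linear differential equations *)

Section LinearODE.
Variable R : realType.

(** The weight of a Bielecki norm, made even in [t] so that times before and after [0] are treated
    together. *)
Definition cosh_weight (a t : R) : R := expR (a * t) + expR (- (a * t)).

Lemma cosh_weight_ge1 a t : 1 <= cosh_weight a t.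
Proof.
have [h|/ltW h] := leP 0 (a * t).
  by rewrite /cosh_weight ler_wpDr ?expR_ge0// -[leLHS]expR0 ler_expR.
by rewrite /cosh_weight ler_wpDl ?expR_ge0// -[leLHS]expR0 ler_expR oppr_ge0.
Qed.

Lemma is_derive_expRM (a t : R) :
  is_derive t (1 : R) (fun s => expR (a * s)) (a * expR (a * t)).
Proof.
have h : is_derive t (1 : R) (fun s => a * s) a.
  have := @is_deriveZ _ _ _ id a t 1 1 (is_derive_id _ _).
  by rewrite /GRing.scale/= mulr1.
by have := is_derive1_comp (is_derive_expR (a * t)) h; rewrite mulrC.
Qed.

(* The weight 2 cosh (a t) dominates a times the absolute value of its own
   primitive 2 sinh (a t) / a, so taking a primitive divides a weighted bound
   by a. *)
Lemma primitive_cosh_weight_bound (f F : R -> R) (a K T : R) :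
  0 < a -> 0 <= K -> F 0 = 0 -> (forall t, is_derive t (1 : R) F (f t)) ->
  (forall t, - T <= t <= T -> `|f t| <= K * cosh_weight a t) ->
  forall t, - T <= t <= T -> `|F t| <= K / a * cosh_weight a t.
Proof.
move=> a0 K0 F0 dF hf.
pose G t := K / a * (expR (a * t) - expR ((- a) * t)).
have dG (t : R) : is_derive t (1 : R) G (K * cosh_weight a t).
  have -> : K * cosh_weight a t =
      K / a *: (a * expR (a * t) - (- a) * expR ((- a) * t)).
    rewrite /cosh_weight /GRing.scale/= !mulNr opprK -mulrDr mulrA mulfVK// gt_eqF//.
  apply: (@is_deriveZ _ _ _ (fun t => expR (a * t) - expR (- a * t))).
  exact: is_deriveB (is_derive_expRM a t) (is_derive_expRM (- a) t).
have G0 : G 0 = 0 by rewrite /G !mulr0 subrr mulr0.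
(* On this interval the derivative of [G] dominates the absolute value of the derivative of [F], so
   [G - F] and [G + F] are both nondecreasing. *)
have mono s t : - T <= s -> s <= t -> t <= T ->
    G s - F s <= G t - F t /\ G s + F s <= G t + F t.
  move=> Ts st tT; split.
    apply: (@derive_ge0_nondecreasing _ (G \- F)
        (fun t => K * cosh_weight a t - f t) (- T) T) => //.
    by move=> u /hf; rewrite ler_norml subr_ge0 => /andP[].
  apply: (@derive_ge0_nondecreasing _ (G \+ F)
      (fun t => K * cosh_weight a t + f t) (- T) T) => //.
  by move=> u /hf; rewrite ler_norml addrC -lerBlDr sub0r => /andP[].
have Gw t : G t <= K / a * cosh_weight a t /\ - G t <= K / a * cosh_weight a t.
  have Ka : 0 <= K / a by rewrite divr_ge0// ltW.
  rewrite /G -mulrN opprB !mulNr.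
  have := expR_ge0 (a * t); have := expR_ge0 (- (a * t)); rewrite /cosh_weight.
  by split; apply: ler_wpM2l => //; lra.
move=> t /andP[Tt tT].
have [g1 g2] := Gw t; rewrite ler_norml.
have [t0|/ltW t0] := leP 0 t.
  have [|m1 m2] := mono 0 t _ t0 tT; first by lra.
  by move: m1 m2; rewrite G0 F0; lra.
have [|m1 m2] := mono t 0 Tt t0; first by lra.
by move: m1 m2; rewrite G0 F0; lra.
Qed.

Lemma continuous_sum (I : Type) (r : seq I) (F : I -> R -> R) :
  (forall i, continuous (F i)) -> continuous (fun x => \sum_(i <- r) F i x).
Proof.
move=> h; elim: r => [|i r IH].
  by under eq_fun do rewrite big_nil; exact: cst_continuous.
under eq_fun do rewrite big_cons.
by move=> x; apply: cvgD; [exact: h | exact: IH].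
Qed.

Lemma continuous_norm_bound (f : R -> R) (T : R) : continuous f ->
  exists2 B, 0 <= B & forall t, - T <= t <= T -> `|f t| <= B.
Proof.
move=> cf; have [T0|T0] := leP 0 T; last first.
  exists 0 => // t /andP[h1 h2]; lra.
have [||c _ hc] := @EVT_max R (fun x => `|f x|) (- T) T.
- by lra.
- apply: continuous_subspaceT => x; apply: continuous_comp; first exact: cf.
  exact: norm_continuous.
by exists `|f c| => // t tT; apply: hc; rewrite in_itv.
Qed.

Lemma continuous_mx_norm_bound m n (A : R -> 'M[R]_(m, n)) (T : R) :
  (forall i j, continuous (fun x => A x i j)) ->
  exists2 B, 0 <= B & forall t, - T <= t <= T -> forall i j, `|A t i j| <= B.
Proof.
move=> cA.
pose s (t : R) := \sum_(ij : 'I_m * 'I_n) `|A t ij.1 ij.2|.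
have [|B B0 hB] := @continuous_norm_bound s T.
  by apply: continuous_sum => ij x; apply: continuous_comp;
    [exact: cA | exact: norm_continuous].
exists B => // t /hB hs i j; apply: le_trans hs; apply: le_trans (ler_norm _).
by rewrite /s (bigD1 (i, j))//= lerDl sumr_ge0.
Qed.

End LinearODE.

(** * Picard iteration and global solutions of linear equations *)

Section Picard.
Variables (R : realType) (n p : nat) (M : R -> 'M[R]_n) (C : 'M[R]_(n, p)).

Definition entry_continuous m q (A : R -> 'M[R]_(m, q)) : Prop :=
  forall i j, continuous (fun x => A x i j).

(** A choice of primitive vanishing at [0]. The default value, the zero function, is returned only
    when no such primitive exists, which [primitiveP] excludes for continuous [f]. *)
Definition primitive (f : R -> R) : R -> R :=
  xget (fun=> 0) [set F : R -> R | F 0 = 0 /\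
    forall t, is_derive t (1 : R) F (f t)].

Lemma primitiveP (f : R -> R) : continuous f ->
  primitive f 0 = 0 /\ forall t, is_derive t (1 : R) (primitive f) (f t).
Proof.
by move=> /continuous_primitive hF; rewrite /primitive; case: xgetP => // /(_ _);
   case: hF => F hF h; have := h F hF.
Qed.

(** The integral operator whose fixed points solve u' = M u with u(0) = C. *)
Definition picard (u : R -> 'M[R]_(n, p)) (t : R) : 'M[R]_(n, p) :=
  \matrix_(i, j) (C i j + primitive (fun s => (M s *m u s) i j) t).

Hypothesis cM : entry_continuous M.

Lemma entry_continuous_mulmx (u : R -> 'M[R]_(n, p)) : entry_continuous u ->
  forall i j, continuous (fun s => (M s *m u s) i j : R).
Proof.
move=> cu i j; under eq_fun do rewrite mxE.
by apply: continuous_sum => k x; apply: cvgM; [exact: cM | exact: cu].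
Qed.

Lemma picard0 (u : R -> 'M[R]_(n, p)) : entry_continuous u -> picard u 0 = C.
Proof.
move=> cu; apply/matrixP => i j; rewrite mxE.
by rewrite (primitiveP (@entry_continuous_mulmx u cu i j)).1 addr0.
Qed.

Lemma is_derive_picard (u : R -> 'M[R]_(n, p)) (t : R) : entry_continuous u ->
  is_derive t (1 : R) (picard u) (M t *m u t).
Proof.
move=> cu; apply/is_derive_mxP => i j; under eq_fun do rewrite mxE.
have [_ /(_ t) h] := primitiveP (@entry_continuous_mulmx u cu i j).
rewrite -[X in is_derive _ _ _ X]add0r.
exact: (is_deriveD (is_derive_cst (C i j) _ _) h).
Qed.

Lemma entry_continuous_picard u : entry_continuous u -> entry_continuous (picard u).
Proof.
move=> cu i j t; apply: is_derive_continuous.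
by have /is_derive_mxP/(_ i j) := is_derive_picard t cu; exact.
Qed.

(* The weight is chosen so that the Picard operator halves weighted distances on
   an interval where the entries of M are bounded by L. *)
Lemma picard_contraction u v (L K T : R) : 0 <= L -> 0 <= K ->
  entry_continuous u -> entry_continuous v ->
  (forall t, - T <= t <= T -> forall i j, `|M t i j| <= L) ->
  (forall t, - T <= t <= T -> forall i j,
     `|u t i j - v t i j| <= K * cosh_weight (2 * (n%:R * L + 1)) t) ->
  forall t, - T <= t <= T -> forall i j,
     `|picard u t i j - picard v t i j| <= K / 2 * cosh_weight (2 * (n%:R * L + 1)) t.
Proof.
move=> L0 K0 cu cv hL huv t tT i j; set a := 2 * (n%:R * L + 1).
have nL0 : 0 <= n%:R * L by rewrite mulr_ge0.
have a0 : 0 < a by rewrite /a; lra.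
have w0 s : 0 <= cosh_weight a s by exact: le_trans (cosh_weight_ge1 a s).
pose F s := picard u s i j - picard v s i j.
have dF (s : R) : is_derive s (1 : R) F ((M s *m u s) i j - (M s *m v s) i j).
  have /is_derive_mxP/(_ i j) h1 := is_derive_picard s cu.
  have /is_derive_mxP/(_ i j) h2 := is_derive_picard s cv.
  exact: is_deriveB h1 h2.
have F0 : F 0 = 0 by rewrite /F !picard0// subrr.
have bF s : - T <= s <= T -> `|(M s *m u s) i j - (M s *m v s) i j| <=
    (n%:R * L * K) * cosh_weight a s.
  move=> sT; rewrite !mxE -sumrB; apply: le_trans (ler_norm_sum _ _ _) _.
  have -> : n%:R * L * K * cosh_weight a s = \sum_(k < n) L * (K * cosh_weight a s).
    by rewrite sumr_const card_ord -[RHS]mulr_natl; ring.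
  apply: ler_sum => k _; rewrite -mulrBr normrM.
  by apply: ler_pM => //; [exact: hL | exact: huv].
have := primitive_cosh_weight_bound a0 _ F0 dF bF tT.
rewrite mulr_ge0// => /(_ isT) /le_trans; apply.
apply: ler_wpM2r => //; rewrite ler_pdivrMr//.
have -> : K / 2 * a = n%:R * L * K + K by rewrite /a; field.
by rewrite lerDl.
Qed.

(** The Picard iterates of the constant [C] converge geometrically in a weighted distance on every
    interval [-T, T]. The limit is continuous and fixed by [picard], hence it solves the equation on
    the whole line. *)
Theorem linear_ode : exists u : R -> 'M[R]_(n, p),
  u 0 = C /\ forall t : R, is_derive t (1 : R) u (M t *m u t).
Proof.
pose u k := iter k picard (fun=> C).
have cu k : entry_continuous (u k).
  elim: k => [i j|k IH]; [exact: cst_continuous | exact: entry_continuous_picard].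
pose a (L : R) := 2 * (n%:R * L + 1).
(* Here [L] bounds [M] on the interval and thereby fixes the weight, while [B] bounds the first
   increment. Each further increment is halved by the contraction. *)
have bound (T : R) : exists L B, [/\ 0 <= L, 0 <= B,
    forall t, - T <= t <= T -> forall i j, `|M t i j| <= L &
    forall t, - T <= t <= T -> forall i j k,
    `|u k.+1 t i j - u k t i j| <= B / 2 ^+ k * cosh_weight (a L) t].
  have [L L0 hL] := continuous_mx_norm_bound T cM.
  have [|B B0 hB] := @continuous_mx_norm_bound R _ _ (fun t => u 1%N t - u 0%N t) T.
    move=> i j; under eq_fun do rewrite mxE [X in _ + X]mxE.
    by move=> x; apply: cvgB; exact: cu.
  exists L, B; split=> // t tT i j k.
  elim: k t tT i j => [|k IH] t tT i j.
    apply: le_trans (ler_peMr _ (cosh_weight_ge1 _ _)); last by rewrite divr_ge0.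
    by rewrite expr0 divr1; have := hB t tT i j; rewrite mxE [X in _ + X]mxE.
  rewrite exprSr invfM mulrA.
  apply: (picard_contraction L0 _ (cu k.+1) (cu k) hL) => //.
  by rewrite divr_ge0// exprn_ge0.
(* The limit is taken pointwise, with its rate stated for every admissible [B]. It does not depend
   on [T], although the weights do. *)
have limit t : exists l : 'M[R]_(n, p), forall B i j,
    (forall k, `|u k.+1 t i j - u k t i j| <= B / 2 ^+ k) ->
    forall k, `|l i j - u k t i j| <= 2 * B / 2 ^+ k.
  have ex i j : exists l, forall B,
    (forall k, `|u k.+1 t i j - u k t i j| <= B / 2 ^+ k) ->
    forall k, `|l - u k t i j| <= 2 * B / 2 ^+ k.
    apply: (@geometric_limit_uniform _ (fun k => u k t i j)).
    have [L [B [_ _ _ hB]]] := bound `|t|; exists (B * cosh_weight (a L) t) => k.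
    by rewrite mulrAC; apply: hB; rewrite -ler_norml.
  have [l hl] := choice (fun ij : 'I_n * 'I_p => ex ij.1 ij.2).
  exists (\matrix_(i, j) l (i, j)) => B i j /(hl (i, j)) h k.
  by rewrite mxE; exact: h.
have [v hv] := choice limit.
have lbound (T : R) : exists L B, [/\ 0 <= L, 0 <= B,
    forall t, - T <= t <= T -> forall i j, `|M t i j| <= L &
    forall t, - T <= t <= T -> forall i j k,
    `|v t i j - u k t i j| <= B / 2 ^+ k * cosh_weight (a L) t].
  have [L [B [L0 B0 hL hB]]] := bound T; exists L, (2 * B).
  split=> [|||t tT i j k] //; first by rewrite mulr_ge0.
  by rewrite mulrAC -(mulrA 2); apply: hv => m; rewrite mulrAC; exact: hB.
(* On a bounded interval the weight is bounded, so weighted convergence is uniform there. *)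
have wT (b t T : R) : 0 <= b -> - T <= t <= T ->
    cosh_weight b t <= 2 * expR (b * T).
  move=> b0 /andP[h1 h2]; rewrite mulr2n mulrDl mul1r lerD// ler_expR.
    by rewrite ler_wpM2l.
  by rewrite -mulrN ler_wpM2l// lerNl.
(* A uniform limit of continuous functions: [e] is split in three parts, on the interval of radius
   [|t| + 1], which is a neighbourhood of [t]. *)
have cv : entry_continuous v.
  move=> i j t; apply/cvgrPdist_lt => /= e e0.
  pose T := `|t| + 1; have [L [B [L0 B0 _ hB]]] := lbound T.
  have a0 : 0 <= a L by rewrite mulr_ge0// addr_ge0// mulr_ge0.
  have [k hk] := exists_halfpow_lt (B * (2 * expR (a L * T))) (divr_gt0 e0 (ltr0Sn R 2)).
  have close s : - T <= s <= T -> `|v s i j - u k s i j| < e / 3.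
    move=> sT; apply: le_lt_trans hk; apply: le_trans (hB s sT i j k) _.
    by rewrite mulrAC; apply: ler_wpM2r; rewrite ?invr_ge0 ?exprn_ge0//
      ler_wpM2l// wT.
  have tT : - T <= t <= T by rewrite -ler_norml lerDl.
  have ct : {for t, continuous (fun x => u k x i j)} by exact: cu.
  move/cvgrPdist_lt : ct => /(_ _ (divr_gt0 e0 (ltr0Sn R 2))) ct.
  near=> s.
  have sT : - T <= s <= T.
    rewrite -ler_norml -[s](subrK t) (le_trans (ler_normD _ _))// addrC lerD2l.
    by rewrite distrC ltW//.
  have h1 := close _ tT; have h2 := close _ sT.
  have h3 : `|u k t i j - u k s i j| < e / 3 by near: s.
  move: h1 h2 h3; rewrite !ltr_norml; lra.
suff pv : picard v = v.
  by exists v; split=> [|t]; rewrite -{1}pv ?picard0//; exact: is_derive_picard.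
apply/funext => t; apply/matrixP => i j.
have [L [B [L0 B0 hL hB]]] := lbound `|t|.
have tt : - `|t| <= t <= `|t| by rewrite -ler_norml.
(* The distance from [picard v] to [v] is split at the iterate [k.+1], which is the image of the
   iterate [k] under [picard]. The contraction bounds one part and the convergence rate the
   other. *)
apply: (@halfpow_bound_eq _ (B * cosh_weight (a L) t)) => k.
rewrite -(subrKA (u k.+1 t i j)); apply: le_trans (ler_normD _ _) _.
rewrite mulrAC; set w := cosh_weight _ _.
have -> : B / 2 ^+ k * w = B / 2 ^+ k / 2 * w + B / 2 ^+ k.+1 * w.
  by rewrite exprSr invfM; field; rewrite expf_neq0.
apply: lerD; last by rewrite distrC; exact: hB.
apply: (picard_contraction L0 _ cv (cu k) hL) => //.
- by rewrite divr_ge0// exprn_ge0.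
- by move=> s sT i' j'; exact: hB.
Unshelve. all: by end_near. Qed.

End Picard.

Lemma smooth_entry_continuous (R : realType) m n (A : R -> 'M[R]_(m, n)) :
  smooth A -> entry_continuous A.
Proof.
move=> /smooth_entryP sA i j t; apply: is_derive_continuous.
exact: diffn_derive (sA 1 i j) t.
Qed.

(** Bootstrapping: the derivative M X is as regular as X, so X gains one order at each step. *)
Lemma smooth_linear_ode_solution (R : realType) n p (M : R -> 'M[R]_n)
    (X : R -> 'M[R]_(n, p)) : smooth M ->
  (forall t : R, is_derive t (1 : R) X (M t *m X t)) -> smooth X.
Proof.
move=> /smoothP sM dX; apply/smoothP; elim=> [//|j IH].
by apply: diffn_is_derive dX _; exact: diffn_mulmx.
Qed.

(** The inverse comes from the adjoint equation Y' = - M^T Y with the same initial value: Y^T X has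
    zero derivative and equals the identity at [0]. *)
Lemma invertible_linear_ode (R : realType) n (M : R -> 'M[R]_n) : smooth M ->
  exists X : R -> 'M[R]_n,
    [/\ smooth X, forall t, X t \in unitmx &
        forall t : R, is_derive t (1 : R) X (M t *m X t)].
Proof.
move=> sM.
have [X [X0 dX]] := linear_ode 1%:M (smooth_entry_continuous sM).
have sN : smooth (fun t => (-1) *: (M t)^T) by exact/smoothZ/smooth_trmx.
have [Y [Y0 dY]] := linear_ode 1%:M (smooth_entry_continuous sN).
exists X; split=> [|t|//]; first exact: smooth_linear_ode_solution sM dX.
have YX : (Y t)^T *m X t = 1%:M.
  have <- : (Y 0)^T *m X 0 = 1%:M by rewrite X0 Y0 trmx1 mulmx1.
  apply: (@derive0_cst_mx _ _ _ (fun t => (Y t)^T *m X t)) => s.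
  have := is_derive_mulmx (is_derive_trmx (dY s)) (dX s).
  rewrite scaleN1r mulNmx linearN/= trmx_mul trmxK mulNmx mulmxA addNr.
  by [].
by have [_] := mulmx1_unit YX.
Qed.

(** * Diagonalisation of symmetric matrices by congruence *)

Section Congruence.
Variable R : realType.

(** Induction on the size: a vector that is not isotropic provides a nonzero pivot, and one
    elimination leaves a symmetric Schur complement of smaller size. *)
Lemma symmetric_congruent_diag n (W : 'M[R]_n) : W^T = W ->
  exists Y d, Y \in unitmx /\ Y *m W *m Y^T = diag_mx d.
Proof.
elim: n W => [|n IH] W sW.
  exists 1%:M, 0; split; first exact: unitmx1.
  by apply/matrixP => -[].
have [[v vWv]|nv] := pselect (exists v : 'rV[R]_n.+1, v *m W *m v^T != 0); last first.
  exists 1%:M, 0; split; first exact: unitmx1.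
  (* If the quadratic form vanishes identically, polarisation on [e i + e j] and the symmetry of [W]
     force [W] to be zero. *)
  have q v : v *m W *m v^T = 0 :> 'M[R]_1.
    by apply/eqP/negP => /negP h; apply: nv; exists v.
  suff -> : W = 0 by rewrite mulmx0 mul0mx; apply/matrixP => i j; rewrite !mxE mul0rn.
  apply/matrixP => i j; rewrite [RHS]mxE.
  pose e k : 'rV[R]_n.+1 := delta_mx 0 k.
  have eWe k l : (e k *m W *m (e l)^T) 0 0 = W k l.
    by rewrite trmx_delta -rowE -colE !mxE.
  have := q (e i + e j).
  rewrite linearD/= !mulmxDl !mulmxDr !q add0r addr0 => /matrixP/(_ 0 0).
  rewrite mxE !eWe mxE -{2}sW mxE => /eqP.
  by rewrite -mulr2n mulrn_eq0/= => /eqP.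
have v0 : v != 0 by apply: contra_neq vWv => ->; rewrite !mul0mx.
(* Completes [v] to a basis: [v] is a scalar multiple of the first row of [E], so the corner entry
   of [B] is nonzero. *)
pose E := row_ebase v.
pose B : 'M[R]_(1 + n) := E *m W *m E^T.
have sB : B^T = B by rewrite /B !trmx_mul trmxK sW mulmxA.
have rv : \rank v = 1%N by rewrite rank_rV v0.
pose e0 : 'rV[R]_n.+1 := delta_mx 0 0.
have vE : v = col_ebase v *m e0 *m E.
  rewrite -{1}(mulmx_ebase v) rv; congr (_ *m _ *m _).
  by apply/matrixP => i j; rewrite !mxE !ord1 eqxx andbT andTb eq_sym.
have B00 : B 0 0 != 0.
  apply: contra_neq vWv => B0.
  have eB : e0 *m B *m e0^T = 0.
    apply/matrixP => i j; rewrite !ord1 [RHS]mxE -B0.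
    by rewrite trmx_delta -rowE -colE !mxE.
  by rewrite vE !trmx_mul -!mulmxA (mulmxA _ W) (mulmxA (E *m W)) -/B (mulmxA B)
    (mulmxA e0) (mulmxA e0) eB mul0mx mulmx0.
set a := B 0 0 in B00.
pose b := ursubmx B; pose D := drsubmx B.
have BE : B = block_mx a%:M b b^T D.
  rewrite -[LHS]submxK; congr block_mx.
    apply/matrixP => i j; rewrite !ord1 [RHS]mxE eqxx mulr1n.
    by rewrite [LHS]mxE [LHS]mxE /a; congr (fun_of_matrix B _ _); apply/val_inj.
  by rewrite /b trmx_ursub sB.
(* Elimination with the pivot [a]: [Z] clears the off-diagonal blocks and leaves the Schur
   complement [D']. *)
pose Z : 'M[R]_(1 + n) := block_mx 1%:M 0 (- a^-1 *: b^T) 1%:M.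
pose D' := D - a^-1 *: (b^T *m b).
have sD : D^T = D by rewrite /D trmx_drsub sB.
have ZB : Z *m B *m Z^T = block_mx a%:M 0 0 D'.
  rewrite BE /Z tr_block_mx !mulmx_block !trmx1 !trmx0 !mul1mx !mul0mx !mulmx1.
  rewrite !mulmx0 !addr0 linearZ/= trmxK.
  have -> : - a^-1 *: b^T *m a%:M + b^T = 0.
    by rewrite mul_mx_scalar scalerA mulrN divff// scaleN1r addNr.
  rewrite mul0mx add0r mul_scalar_mx scalerA mulrN divff// scaleN1r addNr.
  by rewrite -scalemxAl scaleNr addrC.
have sD' : D'^T = D'.
  by rewrite /D' linearB/= linearZ/= trmx_mul trmxK sD.
have [Y [d [uY hY]]] := IH _ sD'.
pose Y1 : 'M[R]_(1 + n) := block_mx 1%:M 0 0 Y.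
exists (Y1 *m Z *m E), (row_mx a%:M d); split.
  have uY1 : Y1 \in unitmx by rewrite /Y1 unitmxE det_lblock det1 mul1r -unitmxE.
  have uZ : Z \in unitmx by rewrite /Z unitmxE det_lblock !det1 mul1r unitr1.
  by rewrite !unitmx_mul row_ebase_unit andbT uY1.
have -> : Y1 *m Z *m E *m W *m (Y1 *m Z *m E)^T = Y1 *m (Z *m B *m Z^T) *m Y1^T.
  by rewrite /B !trmx_mul !mulmxA.
rewrite ZB /Y1 tr_block_mx !mulmx_block !trmx1 !trmx0 !mul1mx !mul0mx !mulmx1.
rewrite !mulmx0 !addr0 !add0r ?mul0mx hY.
apply: etrans (esym (@diag_mx_row _ n 1 a%:M d)); congr block_mx.
by apply/matrixP => i j; rewrite !ord1 !mxE.
Qed.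

End Congruence.

(** * Sylvester normal form over the reals *)

Section Inertia.
Variable R : realType.

Lemma row_perm_congruence n (p : 'S_n) (A W : 'M[R]_n) i j :
  (row_perm p A *m W *m (row_perm p A)^T) i j = (A *m W *m A^T) (p i) (p j).
Proof.
have -> : row_perm p A *m W *m (row_perm p A)^T =
    row_perm p (col_perm p (A *m W *m A^T)).
  by rewrite !row_permE trmx_mul tr_perm_mx col_permE !mulmxA.
by rewrite !mxE.
Qed.

(** After diagonalisation the entries are sorted, which puts the negative ones first, and each is
    scaled to absolute value 1 by the inverse square root of its absolute value. *)
Lemma sylvester_normal_form n (W : 'M[R]_n) : W^T = W -> W \in unitmx ->
  exists k Y, [/\ (k <= n)%N, Y \in unitmx & Y^T *m W *m Y = Ink R n k].
Proof.
move=> sW uW; have [Y [d [uY hY]]] := symmetric_congruent_diag sW.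
have d0 i : d 0 i != 0.
  have : diag_mx d \in unitmx by rewrite -hY !unitmx_mul uY uW unitmx_tr uY.
  by rewrite unitmxE det_diag unitfE => /prodf_neq0/(_ i isT).
pose t := [tuple d 0 i | i < n].
have /tuple_permP[p sE] : perm_eq (sort <=%O t) t by rewrite perm_sort.
have nthE (i : 'I_n) : nth 0 (sort <=%O t) i = d 0 (p i).
  by rewrite sE -tnth_nth !tnth_mktuple.
have srt : sorted <=%O (sort <=%O t) by exact: sort_le_sorted.
pose k := count (< 0) (sort <=%O t).
have dneg (i : 'I_n) : (d 0 (p i) < 0) = (i < k)%N.
  rewrite -nthE; have [ik|ki] := ltnP i k; first exact: nth_count_lt.
  by apply/negbTE; rewrite -leNgt nth_count_ge// ki size_sort size_tuple/=.
pose c := \row_i (Num.sqrt `|d 0 i|)^-1.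
exists k, (row_perm p (diag_mx c *m Y))^T; split.
- by rewrite -[leqRHS](size_tuple t) -(size_sort <=%O) count_size.
- rewrite unitmx_tr row_permE !unitmx_mul unitmx_perm uY andbT/= unitmxE det_diag.
  rewrite unitfE; apply/prodf_neq0 => i _.
  by rewrite mxE invr_eq0 sqrtr_eq0 -ltNge normr_gt0.
apply/matrixP => i j; rewrite trmxK row_perm_congruence.
rewrite !trmx_mul !mulmxA -(mulmxA _ Y) -(mulmxA _ (Y *m W)) hY tr_diag_mx.
rewrite -mulmxA mul_diag_mx mul_mx_diag !mxE (inj_eq perm_inj).
have [->|_] := eqVneq i j; last by rewrite !mulr0n mul0r mulr0.
rewrite !mulr1n mulrCA -invfM -expr2 sqr_sqrtr// -dneg.
have := d0 (p j); case: ltP => [h|h] h0; last by rewrite ger0_norm// divff.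
by rewrite ltr0_norm// invrN mulrN divff.
Qed.

End Inertia.

(** * The law of inertia for Hermitian congruence *)

Section HermitianInertia.
Variable C : numClosedFieldType.

(** Its rows form a basis of the coordinate subspace indexed by [P]. *)
Definition coord_mx n (P : {pred 'I_n}) : 'M[C]_(#|P|, n) :=
  \matrix_(i, j) (enum_val i == j)%:R.

Lemma rank_coord_mx n (P : {pred 'I_n}) : \rank (coord_mx P) = #|P|.
Proof.
apply/eqP; rewrite eqn_leq rank_leq_row/=.
have h : coord_mx P *m (coord_mx P)^T = 1%:M.
  apply/matrixP => i j; rewrite !mxE (bigD1 (enum_val i))//= !mxE eqxx mul1r.
  rewrite big1 ?addr0 => [|k ki]; first by rewrite (inj_eq enum_val_inj) eq_sym.
  by rewrite !mxE eq_sym (negbTE ki) mul0r.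
by rewrite -{1}(mxrank1 C #|P|) -h mxrankM_maxl.
Qed.

Lemma sub_coord_mx n (P : {pred 'I_n}) (u : 'rV[C]_n) j :
  (u <= coord_mx P)%MS -> j \notin P -> u 0 j = 0.
Proof.
move=> /submxP[w ->] jP; rewrite mxE big1// => k _; rewrite !mxE.
by case: eqP => [kj|_]; [rewrite -kj enum_valP in jP | rewrite mulr0].
Qed.

Lemma diag_hermitian_form n (d u : 'rV[C]_n) :
  (u *m diag_mx d *m (map_mx Num.conj u)^T) 0 0 = \sum_i d 0 i * `|u 0 i| ^+ 2.
Proof.
rewrite mul_mx_diag mxE; apply: eq_bigr => i _.
by rewrite !mxE normCK mulrAC mulrC.
Qed.

(* A subspace on which the form is negative definite meets a subspace on which
   it is nonnegative only in 0, so their dimensions add up to at most n. *)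
Lemma inertia_le n (d e : 'rV[C]_n) (Y : 'M[C]_n) : Y \in unitmx ->
  (forall i, d 0 i \is Num.real) ->
  Y *m diag_mx d *m (map_mx Num.conj Y)^T = diag_mx e ->
  (#|[pred i | (e 0 i < 0)%R]| <= #|[pred i | (d 0 i < 0)%R]|)%N.
Proof.
move=> uY rd hY; set N := [pred i | e 0 i < 0]; set D := [pred i | d 0 i < 0].
pose A := coord_mx N *m Y; pose B := coord_mx [predC D].
have rA : \rank A = #|N| by rewrite mxrankMfree ?row_free_unit// rank_coord_mx.
suff AB0 : (A :&: B)%MS = 0.
  have := mxrank_sum_cap A B; rewrite AB0 mxrank0 addn0 rA rank_coord_mx => h.
  have := rank_leq_col (A + B)%MS.
  by rewrite h -[leqRHS](card_ord n) -(cardC D) leq_add2r.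
apply/eqP; rewrite -submx0; apply/rV_subP => v.
rewrite sub_capmx => /andP[/submxP[w vE] vB].
pose u := w *m coord_mx N.
have vu : v = u *m Y by rewrite vE /A mulmxA.
have uN : (u <= coord_mx N)%MS by exact: submxMl.
(* The substitution [v = u *m Y] carries the form of [d] into the form of [e]. *)
have q : \sum_i d 0 i * `|v 0 i| ^+ 2 = \sum_i e 0 i * `|u 0 i| ^+ 2.
  rewrite -!diag_hermitian_form -hY vu map_mxM trmx_mul !mulmxA.
  by rewrite -!mulmxA.
have q0 : 0 <= \sum_i e 0 i * `|u 0 i| ^+ 2.
  rewrite -q sumr_ge0// => i _; have [iD|iD] := boolP (i \in [predC D]).
    rewrite mulr_ge0 ?exprn_ge0//; move: iD; rewrite !inE.
    by rewrite real_ltNge// negbK.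
  by rewrite (sub_coord_mx vB iD) normr0 expr0n mulr0.
have t0 i : e 0 i * `|u 0 i| ^+ 2 <= 0.
  have [iN|iN] := boolP (i \in N); last first.
    by rewrite (sub_coord_mx uN iN) normr0 expr0n mulr0.
  by rewrite mulr_le0_ge0 ?exprn_ge0//; apply: ltW.
have u0 : u = 0.
  apply/rowP => i; rewrite [RHS]mxE; have [iN|iN] := boolP (i \in N); last first.
    exact: sub_coord_mx uN iN.
  have z : \sum_i - (e 0 i * `|u 0 i| ^+ 2) = 0.
    apply/le_anti; rewrite sumr_ge0 ?andbT => [|k _]; last by rewrite oppr_ge0.
    by rewrite sumrN oppr_le0.
  have nn k : true -> 0 <= - (e 0 k * `|u 0 k| ^+ 2) by rewrite oppr_ge0.
  have /eqP := psumr_eq0P nn z (i := i) isT.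
  rewrite oppr_eq0 mulf_eq0 expf_eq0/= normr_eq0 => /orP[|/eqP//].
  by move: iN; rewrite inE => /lt_eqF ->.
by rewrite submx0 vu u0 mul0mx.
Qed.

(** Congruence by the inverse of [Y] exchanges [d] and [e], so the inequality holds in both
    directions. *)
Lemma inertia_eq n (d e : 'rV[C]_n) (Y : 'M[C]_n) : Y \in unitmx ->
  (forall i, d 0 i \is Num.real) -> (forall i, e 0 i \is Num.real) ->
  Y *m diag_mx d *m (map_mx Num.conj Y)^T = diag_mx e ->
  #|[pred i | (e 0 i < 0)%R]| = #|[pred i | (d 0 i < 0)%R]|.
Proof.
move=> uY rd re hY; apply/eqP; rewrite eqn_leq (inertia_le uY rd hY)/=.
apply: (@inertia_le _ e d (invmx Y)) => //; first by rewrite unitmx_inv.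
rewrite -hY map_invmx trmx_inv !mulmxA mulVmx// mul1mx mulmxK//.
by rewrite unitmx_tr map_unitmx.
Qed.

End HermitianInertia.

(** * The number of negative eigenvalues is a congruence invariant *)

Section Signature.
Variable R : realType.

Lemma char_poly_conjugate (F : fieldType) n (P A : 'M[F]_n) : P \in unitmx ->
  char_poly (invmx P *m A *m P) = char_poly A.
Proof.
move=> uP; rewrite /char_poly.
have -> : char_poly_mx (invmx P *m A *m P) =
    map_mx polyC (invmx P) *m char_poly_mx A *m map_mx polyC P.
  rewrite /char_poly_mx mulmxBr mulmxBl -!map_mxM; congr (_ - _).
  by rewrite scalar_mxC -mulmxA -map_mxM mulVmx// map_mx1 mulmx1.
rewrite !det_mulmx !det_map_mx mulrAC -rmorphM/= -det_mulmx mulVmx// det1.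
by rewrite mul1r.
Qed.

Lemma conj_map_real_complex m n (A : 'M[R]_(m, n)) :
  map_mx Num.conj (map_mx (real_complex R) A) = map_mx (real_complex R) A.
Proof. by apply/matrixP => i j; rewrite !mxE; exact: conjc_real. Qed.

(** The spectral theorem over [R[i]] makes the real symmetric matrix [S] unitarily diagonal with
    real eigenvalues. Both this diagonal and the one of [Ink R n k] are congruent to [S], so the law
    of inertia equates their numbers of negative entries. *)
Theorem neg_index_congruence n k (X : 'M[R]_n) : (k <= n)%N -> X \in unitmx ->
  neg_index (X^T *m Ink R n k *m X) = k.
Proof.
move=> kn uX; set S := _ *m X.
pose c m := map_mx (real_complex R) (m : 'M[R]_n).
have sS : S^T = S by rewrite /S !trmx_mul trmxK /Ink tr_diag_mx mulmxA.
have hS : c S \is hermsymmx.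
  apply/is_hermitianmxP; rewrite expr0 scale1r.
  by rewrite [LHS]/c -{1}sS -!map_trmx conj_map_real_complex.
set P := spectralmx (c S); set sp := spectral_diag (c S).
have uP : P \in unitmx by exact: spectral_unit.
have SE : c S = invmx P *m diag_mx sp *m P.
  exact/orthomx_spectralP/hermitian_normalmx.
have rsp i : sp 0 i \is Num.real.
  by have /mxOverP := hermitian_spectral_diag_real hS; exact.
(* The spectral values are real, so their real parts split the characteristic polynomial already
   over [R], as [neg_index_split] demands. *)
pose r := [seq complex.Re (sp 0 i) | i <- enum 'I_n].
have cpS : char_poly S = \prod_(x <- r) ('X - x%:P).
  apply: (map_poly_inj (real_complex R)).
  rewrite map_char_poly -/(c S) SE char_poly_conjugate//.
  rewrite char_poly_trig ?diag_mx_is_trig//.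
  rewrite rmorph_prod big_map big_enum/=; apply: eq_bigr => i _.
  rewrite mxE eqxx mulr1n rmorphB/= map_polyX map_polyC/=; congr (_ - _%:P).
  by rewrite RRe_real.
rewrite (neg_index_split cpS) count_map.
pose e : 'rV[R[i]]_n := \row_(i < n) if (i < k)%N then -1 else 1.
have cI : c (Ink R n k) = diag_mx e.
  rewrite /c /Ink map_diag_mx; congr diag_mx; apply/rowP => i; rewrite !mxE.
  by case: ifP; rewrite ?rmorphN rmorph1.
have uXc : c X \in unitmx by rewrite /c map_unitmx.
have cS : c S = (c X)^T *m diag_mx e *m c X by rewrite /c !map_mxM -map_trmx -!/(c _) cI.
(* Goes from the diagonal of eigenvalues back to [c S], then undoes the congruence by [X]. *)
pose Y := invmx (c X)^T *m invmx P.
have uXt : (c X)^T \in unitmx by rewrite unitmx_tr.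
have uY : Y \in unitmx by rewrite unitmx_mul !unitmx_inv uXt.
have re i : e 0 i \is Num.real by rewrite mxE; case: ifP; rewrite ?rpredN real1.
have YE : Y *m diag_mx sp *m (map_mx Num.conj Y)^T = diag_mx e.
  have -> : (map_mx Num.conj Y)^T = P *m invmx (c X).
    rewrite map_mxM trmx_mul; congr (_ *m _); last first.
      by rewrite map_invmx trmx_inv -map_trmx trmxK conj_map_real_complex.
    rewrite invmx_unitary ?spectral_unitarymx// -map_mx_comp.
    by rewrite map_mx_id ?trmxK// => x; exact: conjCK.
  rewrite /Y -!mulmxA (mulmxA (invmx P)) (mulmxA _ P) -SE cS mulmxK//.
  by rewrite mulKmx.
have card_e : #|[pred i | e 0 i < 0]| = k.
  rewrite -sum1_card (eq_bigl (fun i : 'I_n => (i < k)%N)) => [|i].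
    by rewrite (big_ord_narrow kn) sum1_card card_ord.
  by rewrite !inE mxE; case: ifP => _; rewrite ?oppr_lt0 ?ltr01// ltr10.
rewrite -[RHS]card_e (inertia_eq uY rsp re YE) cardE -size_filter.
rewrite enumT; congr size; apply: eq_filter => i /=.
by rewrite -ltcR RRe_real// !inE.
Qed.

Lemma neg_index_Ink n k : (k <= n)%N -> neg_index (Ink R n k) = k.
Proof.
move=> kn; have := neg_index_congruence kn (unitmx1 R n).
by rewrite trmx1 mul1mx mulmx1.
Qed.

End Signature.

(** * Column spans as vector spaces and as matrix factorisations *)

Section Colspan.
Variables (R : realType) (m : nat).

Lemma mulmx_col_sum p (A : 'M[R]_(m, p)) (x : 'cV[R]_p) :
  A *m x = \sum_j x j 0 *: col j A.
Proof.
apply/matrixP => i k; rewrite ord1 mxE summxE; apply: eq_bigr => j _.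
by rewrite !mxE mulrC.
Qed.

Lemma colspanP p (A : 'M[R]_(m, p)) (v : 'cV[R]_m) :
  reflect (exists x, v = A *m x) (v \in colspan A).
Proof.
rewrite /colspan span_def big_image; apply: (iffP memv_sumP).
  move=> [vs vsP ->]; have /choice[k hk] : forall j, exists k, vs j = k *: col j A.
    by move=> j; have /vlineP[k ->] := vsP j isT; exists k.
  exists (\col_j k j); rewrite mulmx_col_sum; apply: eq_bigr => j _.
  by rewrite hk mxE.
move=> [x ->]; exists (fun j => x j 0 *: col j A) => [j _|].
  by rewrite memvZ// memv_line.
exact: mulmx_col_sum.
Qed.

Lemma colspan_subP p q (A : 'M[R]_(m, p)) (B : 'M[R]_(m, q)) :
  reflect (exists X, B = A *m X) (colspan B <= colspan A)%VS.
Proof.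
apply: (iffP subvP) => [sub|[X ->] v /colspanP[x ->]]; last first.
  by apply/colspanP; exists (X *m x); rewrite mulmxA.
have /choice[x hx] : forall j, exists x, col j B = A *m x.
  move=> j; apply/colspanP/sub/colspanP; exists (delta_mx j 0).
  exact: colE.
exists (\matrix_(i, j) x j i 0); apply/matrixP => i j.
have /matrixP/(_ i 0) := hx j; rewrite !mxE => ->.
by apply: eq_bigr => k _; rewrite !mxE.
Qed.

Lemma colspan_mulmx_unit p (A : 'M[R]_(m, p)) (X : 'M[R]_p) : X \in unitmx ->
  colspan (A *m X) = colspan A.
Proof.
move=> uX; apply/eqP; rewrite eqEsubv; apply/andP; split; apply/colspan_subP.
  by exists X.
by exists (invmx X); rewrite mulmxK.
Qed.

Lemma limg_colspan p (S : 'M[R]_m) (A : 'M[R]_(m, p)) :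
  (linfun (mulmx S : 'cV[R]_m -> 'cV[R]_m) @: colspan A)%VS = colspan (S *m A).
Proof.
apply/vspaceP => v; apply/memv_imgP/colspanP => [[u /colspanP[x ->] ->]|[x ->]].
  by exists x; rewrite lfunE/= mulmxA.
by exists (A *m x); [apply/colspanP; exists x | rewrite lfunE/= mulmxA].
Qed.

End Colspan.

(** * The symplectic form and the Wronskian of Lagrangian frames *)

Section Frames.
Variables (R : realType) (n : nat).
Implicit Types A B : R -> 'M[R]_(n + n, n).
Local Notation J := (sympl_mx R n).

Lemma tr_sympl_mx : J^T = - J.
Proof.
by rewrite /sympl_mx tr_block_mx opp_block_mx !trmx0 linearN/= !trmx1 !oppr0 opprK.
Qed.

Lemma sympl_mx_unit : J \in unitmx.
Proof.
have /mulmx1_unit[] // : J *m (- J) = 1%:M.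
rewrite mulmxN /sympl_mx mulmx_block !mul0mx !mulmx0 !mul1mx !mulmx1.
by rewrite !add0r !addr0 opp_block_mx opprK !oppr0 -scalar_mx_block.
Qed.

Lemma symplectic_unit (S : 'M[R]_(n + n)) : symplectic S -> S \in unitmx.
Proof.
move=> hS; have := sympl_mx_unit; rewrite -hS unitmx_mul => /andP[_].
by [].
Qed.

Lemma derive1n2 A : derive1n 2 A = derive1 (derive1 A).
Proof. by []. Qed.

Lemma fanning_comb A t (X Y : 'M[R]_n) : fanning_frame A ->
  A t *m X + derive1 A t *m Y = 0 -> X = 0 /\ Y = 0.
Proof.
move=> [_ /(_ t) uA]; rewrite -mul_row_col => h.
have : col_mx X Y = 0 by rewrite -[LHS](mulKmx uA) h mulmx0.
by rewrite -col_mx0 => /eq_col_mx[].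
Qed.

Section Isotropic.
Variable A : R -> 'M[R]_(n + n, n).
Hypotheses (sA : smooth A) (lA : forall t, lagrangian_frame (A t)).

(** Differentiates the isotropy relation A^T J A = 0. *)
Lemma derive_isotropic t :
  (derive1 A t)^T *m J *m A t + (A t)^T *m J *m derive1 A t = 0.
Proof.
have dA := smooth_is_derive t sA.
have := is_derive_mulmx (is_derive_mulmx (is_derive_trmx dA)
  (is_derive_cst J t 1)) dA.
rewrite mulmx0 addr0 => /is_derive1E <-.
rewrite (_ : (fun _ => _) = cst 0); first exact: derive1_cst.
by apply/funext => x; case: (lA x).
Qed.

Lemma wronskianE t : wronskian A t = (derive1 A t)^T *m J *m A t.
Proof. by apply/eqP; rewrite eqr_oppLR -addr_eq0 addrC derive_isotropic. Qed.

Lemma tr_wronskian t : (wronskian A t)^T = wronskian A t.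
Proof.
rewrite [RHS]wronskianE /wronskian linearN/= !trmx_mul trmxK tr_sympl_mx.
by rewrite mulNmx mulmxN opprK mulmxA.
Qed.

(** A row vector [v] killed by the Wronskian extends by zero to one killed by the Gram matrix of (A
    | A'), because A^T J A = 0. That Gram matrix is invertible. *)
Lemma wronskian_unit t : fanning_frame A -> wronskian A t \in unitmx.
Proof.
move=> [_ /(_ t) uN]; set N := row_mx _ _ in uN.
have uK : N^T *m J *m N \in unitmx.
  by rewrite !unitmx_mul unitmx_tr uN sympl_mx_unit.
rewrite -row_free_unit; apply: inj_row_free => v vW.
have : row_mx v 0 *m (N^T *m J *m N) = 0.
  rewrite /N tr_row_mx mul_col_mx mul_col_row mul_row_block !mul0mx !addr0.
  have [_ ->] := lA t.
  rewrite mulmx0 -[_ *m derive1 A t]opprK -/(wronskian A t) mulmxN vW oppr0.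
  by rewrite row_mx0.
move/(congr1 (mulmx^~ (invmx (N^T *m J *m N)))); rewrite mulmxK// mul0mx.
by rewrite -row_mx0 => /eq_row_mx[].
Qed.

End Isotropic.

End Frames.

(** * Normal frames, changes of frame and symplectic images *)

Section NormalFrames.
Variables (R : realType) (n : nat).
Implicit Types A B : R -> 'M[R]_(n + n, n).
Local Notation J := (sympl_mx R n).

Lemma derive1_mulmx m p q (A : R -> 'M[R]_(m, p)) (X : R -> 'M[R]_(p, q)) t :
  smooth A -> smooth X ->
  derive1 (fun s => A s *m X s) t = derive1 A t *m X t + A t *m derive1 X t.
Proof.
by move=> sA sX; apply: is_derive1E; apply: is_derive_mulmx;
  exact: smooth_is_derive.
Qed.

Lemma derive1_mull m p q (M : 'M[R]_(m, p)) (X : R -> 'M[R]_(p, q)) t :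
  smooth X -> derive1 (fun s => M *m X s) t = M *m derive1 X t.
Proof.
move=> sX; rewrite (@derive1_mulmx _ _ _ (fun=> M))//; last exact: smooth_cst.
by rewrite (derive1_cst M t) mul0mx add0r.
Qed.

Lemma derive2_mull m p q (M : 'M[R]_(m, p)) (X : R -> 'M[R]_(p, q)) t :
  smooth X -> derive1n 2 (fun s => M *m X s) t = M *m derive1n 2 X t.
Proof.
move=> sX; rewrite -(derive1_mull _ _ (smooth_derive1 sX)) derive1Sn derive1n1.
by congr (derive1 _ t); apply/funext => s; exact: derive1_mull.
Qed.

Lemma derive2_mulmx m p q (A : R -> 'M[R]_(m, p)) (X : R -> 'M[R]_(p, q)) t :
  smooth A -> smooth X ->
  derive1n 2 (fun s => A s *m X s) t =
  derive1n 2 A t *m X t + derive1 A t *m derive1 X t *+ 2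
    + A t *m derive1n 2 X t.
Proof.
move=> sA sX; rewrite derive1Sn derive1n1.
have -> : derive1 (fun s => A s *m X s) =
    fun s => derive1 A s *m X s + A s *m derive1 X s.
  by apply/funext => s; exact: derive1_mulmx.
have sA' := smooth_derive1 sA; have sX' := smooth_derive1 sX.
have h1 := is_derive_mulmx (smooth_is_derive t sA') (smooth_is_derive t sX).
have h2 := is_derive_mulmx (smooth_is_derive t sA) (smooth_is_derive t sX').
apply: etrans (is_derive1E (is_deriveD h1 h2)) _.
by rewrite mulr2n !addrA.
Qed.

Lemma derive2_mulr m p q (A : R -> 'M[R]_(m, p)) (X : 'M[R]_(p, q)) t :
  smooth A -> derive1n 2 (fun s => A s *m X) t = derive1n 2 A t *m X.
Proof.
move=> sA; have sX : smooth (fun _ : R => X) by exact: smooth_cst.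
have X'0 : derive1 (fun _ : R => X) = fun=> 0.
  by apply/funext => s; exact: derive1_cst.
rewrite (derive2_mulmx _ sA sX) [derive1n 2 (fun=> X)]derive1Sn derive1n1 X'0.
by rewrite (derive1_cst 0 t) !mulmx0 mul0rn !addr0.
Qed.

Lemma frame_coef_second_derivative A t (Q : 'M[R]_n) : fanning_frame A ->
  derive1n 2 A t = - (A t *m Q) -> frameP A t = 0 /\ frameQ A t = Q.
Proof.
move=> fA h; have [] := (frame_coefP t 0 Q fA).1; last by move=> <- <-.
by rewrite h mulmx0 addr0 addNr.
Qed.

Lemma normal_second_derivative A t : lagrangian_normal_frame A ->
  derive1n 2 A t = - (A t *m frameQ A t).
Proof.
move=> [fA _ /(_ t) /colspan_subP[X hX] _].
have h : derive1n 2 A t = - (A t *m - X) by rewrite mulmxN opprK.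
by have [_ ->] := frame_coef_second_derivative fA h.
Qed.

Lemma schwarzian_normal A t : lagrangian_normal_frame A ->
  schwarzian A t = 2%:R *: frameQ A t.
Proof.
move=> nA; have fA : fanning_frame A by case: nA.
have P0 : frameP A = cst 0.
  apply/funext => s.
  by have [] := frame_coef_second_derivative fA (normal_second_derivative s nA).
by rewrite /schwarzian P0 /cst mulmx0 scaler0 subr0 (derive1_cst 0 t) subr0.
Qed.

Lemma wronskian_mulmx A X t : smooth A -> (forall s, lagrangian_frame (A s)) ->
  smooth X -> wronskian (fun s => A s *m X s) t = (X t)^T *m wronskian A t *m X t.
Proof.
move=> sA lA sX; rewrite /wronskian derive1_mulmx// trmx_mul mulmxDr.
rewrite !mulmxA -(mulmxA _ (A t)^T J) -(mulmxA _ _ (A t)).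
by have [_ ->] := lA t; rewrite mulmx0 mul0mx addr0 mulmxN mulNmx !mulmxA.
Qed.

Lemma lagrangian_mulmx (A : 'M[R]_(n + n, n)) (X : 'M[R]_n) :
  X \in unitmx -> lagrangian_frame A -> lagrangian_frame (A *m X).
Proof.
move=> uX [rA iA]; split; first by rewrite mxrankMfree// row_free_unit.
by rewrite trmx_mul !mulmxA -(mulmxA _ A^T) -(mulmxA _ (A^T *m J)) iA mulmx0 mul0mx.
Qed.

(* The transition matrix is X = W_A^-1 A'^T J B, since A^T J A = 0 and
   A'^T J A = W_A. *)
Lemma transition_frame A B : fanning_frame A ->
  (forall t, lagrangian_frame (A t)) -> smooth B ->
  (forall t, lagrangian_frame (B t)) ->
  (forall t, colspan (B t) = colspan (A t)) ->
  exists X, [/\ smooth X, forall t, X t \in unitmx & forall t, B t = A t *m X t].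
Proof.
move=> fA lA sB lB AB; have sA : smooth A by case: fA.
have uW t : wronskian A t \in unitmx by exact: wronskian_unit.
have sW : smooth (wronskian A).
  rewrite (_ : wronskian A = fun t => (derive1 A t)^T *m J *m A t).
    apply: smooth_mulmx => //; apply: smooth_mulmx; last exact: smooth_cst.
    exact/smooth_trmx/smooth_derive1.
  by apply/funext => t; exact: wronskianE.
pose X t := invmx (wronskian A t) *m ((derive1 A t)^T *m J *m B t).
have BX t : B t = A t *m X t.
  have /colspan_subP[Y hY] : (colspan (B t) <= colspan (A t))%VS by rewrite AB.
  by rewrite /X hY (mulmxA _ (A t)) -wronskianE// mulKmx.
exists X; split=> [|t|//].
  apply: smooth_mulmx; first exact: smooth_invmx.
  apply: smooth_mulmx; last exact: sB; apply: smooth_mulmx; last exact: smooth_cst.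
  exact/smooth_trmx/smooth_derive1.
(* Since [B t] has rank [n] and factors through [X t], the latter has full rank. *)
rewrite -row_full_unit /row_full eqn_leq rank_leq_col/=.
by have [rB _] := lB t; rewrite -[leqLHS]rB BX mxrankM_maxr.
Qed.

(** Any smooth Lagrangian frame of the curve is A X with X invertible, so its Wronskian is congruent
    to [Ink R n k] and the law of inertia applies. *)
Lemma normal_has_signature A l k : (k <= n)%N -> lagrangian_normal_frame A ->
  spans A l -> (forall t, wronskian A t = Ink R n k) -> has_signature l k.
Proof.
move=> kn [fA lA _ _] Al WA B sB lB Bl t.
have [|X [sX uX BX]] := transition_frame fA lA sB lB; first by move=> s; rewrite -Bl Al.
have sA : smooth A by case: fA.
rewrite (_ : B = fun s => A s *m X s); last exact/funext.
by rewrite wronskian_mulmx// WA neg_index_congruence.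
Qed.

(** Identifies the index hidden in the definition of a normal frame with the signature of the curve
    it spans. *)
Lemma normal_wronskian_signature A l k : lagrangian_normal_frame A ->
  spans A l -> has_signature l k -> forall t, wronskian A t = Ink R n k.
Proof.
move=> nA Al lk t; have [[sA _] lA _ [k' k'n WA]] := nA.
by have := lk A sA lA Al t; rewrite WA neg_index_Ink// => ->.
Qed.

(** A constant [S] commutes with differentiation, which preserves the equation A'' = - A Q, and it
    preserves the form, hence isotropy and the Wronskian. *)
Lemma symplectic_normal (S : 'M[R]_(n + n)) A : symplectic S ->
  lagrangian_normal_frame A ->
  [/\ lagrangian_normal_frame (fun t => S *m A t),
      forall t, wronskian (fun t => S *m A t) t = wronskian A t &
      forall t, frameQ (fun t => S *m A t) t = frameQ A t].
Proof.
move=> hS nA; have uS := symplectic_unit hS.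
have [[sA uA] lA cA [k kn WA]] := nA.
have sSA : smooth (fun t => S *m A t) by apply: smooth_mulmx => //; exact: smooth_cst.
have form (M N : 'M[R]_(n + n, n)) : (S *m M)^T *m J *m (S *m N) = M^T *m J *m N.
  have -> : (S *m M)^T *m J *m (S *m N) = M^T *m (S^T *m J *m S) *m N.
    by rewrite trmx_mul !mulmxA.
  by rewrite hS.
have WS t : wronskian (fun t => S *m A t) t = wronskian A t.
  by rewrite /wronskian derive1_mull// form.
have fSA : fanning_frame (fun t => S *m A t).
  split=> [|t]; first exact: sSA.
  by rewrite derive1_mull -?mul_mx_row ?unitmx_mul ?uS ?uA.
split; [|exact: WS|]; last first.
  move=> t; have [|_ ->//] := @frame_coef_second_derivative _ t (frameQ A t) fSA.
  by rewrite derive2_mull// normal_second_derivative// mulmxN mulmxA.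
split; [exact: fSA| | |by exists k; [exact: kn | move=> t; rewrite WS]].
- move=> t; have [rA iA] := lA t; split; last by rewrite form.
  by rewrite -mxrank_tr trmx_mul mxrankMfree ?mxrank_tr// row_free_unit unitmx_tr.
- move=> t; rewrite derive2_mull// normal_second_derivative//.
  by apply/colspan_subP; exists (- frameQ A t); rewrite mulmxN mulmxN mulmxA.
Qed.

End NormalFrames.

(** * Comparison of two normal frames *)

Section CongruenceCriterion.
Variables (R : realType) (n : nat).
Implicit Types A B : R -> 'M[R]_(n + n, n).
Local Notation J := (sympl_mx R n).

Lemma Ink_unit k : Ink R n k \in unitmx.
Proof.
rewrite /Ink unitmxE det_diag unitfE; apply/prodf_neq0 => i _.
by rewrite mxE; case: ifP; rewrite ?oppr_eq0 oner_eq0.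
Qed.

Lemma indefinite_orthogonal_unit k (X : 'M[R]_n) :
  indefinite_orthogonal k X -> X \in unitmx.
Proof.
by move=> hX; have := Ink_unit k; rewrite -hX unitmx_mul => /andP[_].
Qed.

(* Writing B = A X and comparing second derivatives gives A' X' in the span of
   A, whence X' = 0. *)
Lemma normal_frames_same_span A B : lagrangian_normal_frame A ->
  lagrangian_normal_frame B -> (forall t, colspan (B t) = colspan (A t)) ->
  exists X : 'M[R]_n, X \in unitmx /\ forall t, B t = A t *m X.
Proof.
move=> nA nB AB; have [fA lA _ _] := nA; have [fB lB _ _] := nB.
have sA : smooth A by case: fA.
have sB : smooth B by case: fB.
have [X [sX uX BX]] := transition_frame fA lA sB lB AB.
have BE : B = fun t => A t *m X t by apply/funext.
have X'0 t : derive1 X t = 0.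
  have := normal_second_derivative t nB.
  rewrite {1}BE derive2_mulmx// (normal_second_derivative t nA) BX => /eqP.
  rewrite -subr_eq0 opprK => /eqP h.
  (* The comparison of second derivatives, sorted into its components along A and A'. The latter is
     2 X'. *)
  have [|_] := @fanning_comb _ _ A t
    (- (frameQ A t *m X t) + derive1n 2 X t + X t *m frameQ B t)
    (derive1 X t *+ 2) fA.
    rewrite -[RHS]h !mulr2n !mulmxDr mulmxN mulNmx !mulmxA.
    by rewrite addrAC (addrAC _ _ (_ + _)).
  by rewrite -scaler_nat => /eqP; rewrite scaler_eq0 pnatr_eq0/= => /eqP.
exists (X 0); split=> [|t]; first exact: uX.
rewrite BX; congr (_ *m _); apply: derive0_cst_mx => s.
by rewrite -(X'0 s); exact: smooth_is_derive.
Qed.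

Lemma normal_frames_conjugate A B k : lagrangian_normal_frame A ->
  lagrangian_normal_frame B -> (forall t, colspan (B t) = colspan (A t)) ->
  (forall t, wronskian A t = Ink R n k) ->
  (forall t, wronskian B t = Ink R n k) ->
  schwarzians_conjugate k A B.
Proof.
move=> nA nB AB WA WB; have [fA lA _ _] := nA; have [fB _ _ _] := nB.
have sA : smooth A by case: fA.
have [X [uX BX]] := normal_frames_same_span nA nB AB.
have BE : B = fun t => A t *m X by apply/funext.
have sX : smooth (fun _ : R => X) by exact: smooth_cst.
exists X => [|t].
  apply: etrans (WB 0).
  by rewrite BE (wronskian_mulmx 0 sA lA sX) WA.
rewrite !schwarzian_normal// -scalemxAr -scalemxAl; congr (_ *: _).
have [|//] := @frame_coef_second_derivative _ _ B t (invmx X *m frameQ A t *m X) fB.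
rewrite BX !mulmxA mulmxK// {1}BE derive2_mulr//.
by rewrite (normal_second_derivative t nA) mulNmx.
Qed.

(* For A1 = A X both A1 and B solve F'' = - F Q, so (A1 | A1') and (B | B')
   satisfy the same linear equation and have the same constant Gram matrix for
   the symplectic form. *)
Lemma normal_frames_congruent A B k : lagrangian_normal_frame A ->
  lagrangian_normal_frame B ->
  (forall t, wronskian A t = Ink R n k) ->
  (forall t, wronskian B t = Ink R n k) ->
  schwarzians_conjugate k A B ->
  exists2 S : 'M[R]_(n + n), symplectic S &
    forall t, colspan (B t) = colspan (S *m A t).
Proof.
move=> nA nB WA WB [X oX QX]; have uX := indefinite_orthogonal_unit oX.
have [[sA uA] lA _ _] := nA; have [[sB uB] lB _ _] := nB.
pose Q := frameQ B.
have QE t : X *m Q t = frameQ A t *m X.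
  have := QX t; rewrite !schwarzian_normal// -scalemxAr -scalemxAl => /scalerI.
  by move=> /(_ (lt0r_neq0 (ltr0Sn R 1))) h; rewrite /Q h -!mulmxA mulKVmx.
pose A1 t := A t *m X.
have sX : smooth (fun _ : R => X) by exact: smooth_cst.
have sA1 : smooth A1 by exact: smooth_mulmx.
have lA1 t : lagrangian_frame (A1 t) by exact: lagrangian_mulmx.
have WA1 t : wronskian A1 t = Ink R n k.
  by rewrite (wronskian_mulmx t sA lA sX) WA.
have A1' t : derive1 A1 t = derive1 A t *m X.
  by rewrite derive1_mulmx// (derive1_cst X t) mulmx0 addr0.
have A1'' t : derive1n 2 A1 t = - (A1 t *m Q t).
  rewrite derive2_mulr// (normal_second_derivative t nA) mulNmx -mulmxA -QE.
  by rewrite mulmxA.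
have B'' t : derive1n 2 B t = - (B t *m Q t) by exact: normal_second_derivative.
pose N t := row_mx (A1 t) (derive1 A1 t).
pose M t := row_mx (B t) (derive1 B t).
(* The companion matrix of F'' = - F Q, acting on (F | F') from the right. *)
pose C t : 'M[R]_(n + n) := block_mx 0 (- Q t) 1%:M 0.
have ode F t : smooth F -> (derive1n 2 F t = - (F t *m Q t)) ->
    is_derive t (1 : R) (fun s => row_mx (F s) (derive1 F s))
      (row_mx (F t) (derive1 F t) *m C t).
  move=> sF F''; rewrite /C mul_row_block !mulmx0 mulmx1 add0r addr0 mulmxN -F''.
  apply: is_derive_row_mx; first exact: smooth_is_derive.
  exact: smooth_is_derive (smooth_derive1 sF).
have dN t : is_derive t (1 : R) N (N t *m C t) by exact: ode.
have dM t : is_derive t (1 : R) M (M t *m C t) by exact: ode.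
have uN t : N t \in unitmx.
  have -> : N t = row_mx (A t) (derive1 A t) *m block_mx X 0 0 X.
    by rewrite mul_row_block !mulmx0 addr0 add0r /N A1'.
  by rewrite unitmx_mul uA unitmxE det_ublock unitrM -!unitmxE uX.
have gram F t : smooth F -> (forall s, lagrangian_frame (F s)) ->
    (forall s, wronskian F s = Ink R n k) ->
    derive1n 2 F t = - (F t *m Q t) ->
    (row_mx (F t) (derive1 F t))^T *m J *m row_mx (F t) (derive1 F t) =
    block_mx 0 (- Ink R n k) (Ink R n k) 0.
  move=> sF lF WF F''; have [_ iF] := lF t.
  rewrite tr_row_mx mul_col_mx mul_col_row iF -(wronskianE sF lF t) WF.
  congr block_mx; first by rewrite -(WF t) opprK.
  (* The remaining block F'^T J F' vanishes: in the derivative of the constant Wronskian F'^T J F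
     the other term is - Q^T F^T J F = 0. *)
  have sF' := smooth_derive1 sF.
  have h := is_derive_mulmx (is_derive_mulmx (is_derive_trmx (smooth_is_derive t sF'))
    (is_derive_cst J t 1)) (smooth_is_derive t sF).
  rewrite (_ : (fun _ => _) = fun=> Ink R n k) in h; last first.
    by apply/funext => s; rewrite -wronskianE.
  have := is_derive1E h; rewrite (derive1_cst _ t) mulmx0 addr0 -derive1n2 F''.
  rewrite linearN/= trmx_mul !mulNmx -!mulmxA (mulmxA (F t)^T) iF mulmx0 oppr0 add0r.
  by rewrite mulmxA => /esym.
pose K : 'M[R]_(n + n) := block_mx 0 (- Ink R n k) (Ink R n k) 0.
have KN t : (N t)^T *m J *m N t = K by exact: gram.
have KM t : (M t)^T *m J *m M t = K by exact: gram.
have uK : K \in unitmx.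
  by rewrite -(KN 0) !unitmx_mul unitmx_tr uN sympl_mx_unit.
(* Differentiating the constant Gram matrix of N gives C^T K + K C = 0. *)
have CK t : invmx K *m (C t)^T = - (C t *m invmx K).
  have h := is_derive_mulmx (is_derive_mulmx (is_derive_trmx (dN t))
    (is_derive_cst J t 1)) (dN t).
  rewrite (_ : (fun _ => _) = fun=> K) in h; last by apply/funext => s; rewrite KN.
  have e : (C t)^T *m K + K *m C t = 0.
    rewrite -(KN t) !mulmxA; have := is_derive1E h.
    by rewrite (derive1_cst K t) mulmx0 addr0 trmx_mul !mulmxA => /esym.
  move/eqP: e; rewrite addr_eq0 => /eqP CTK.
  by rewrite -[(C t)^T](mulmxK uK) CTK mulNmx mulmxN -!mulmxA mulKmx.
(* This is M N^-1, because N^T J N = K. Written in this way, it is differentiated without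
   differentiating an inverse. *)
pose S t := M t *m invmx K *m (N t)^T *m J.
have dS t : is_derive t (1 : R) S 0.
  have h := is_derive_mulmx (is_derive_mulmx (is_derive_mulmx (dM t)
    (is_derive_cst (invmx K) t 1)) (is_derive_trmx (dN t))) (is_derive_cst J t 1).
  apply: is_derive_eq h _.
  rewrite !mulmx0 !addr0 trmx_mul !mulmxA -(mulmxA (M t) (invmx K) (C t)^T) CK.
  by rewrite mulmxN mulNmx !mulmxA subrr mul0mx.
have [S0 SN] : exists S0, forall t, S0 *m N t = M t.
  exists (S 0) => t; rewrite (derive0_cst_mx dS 0 t) /S -!mulmxA (mulmxA _ J) KN.
  rewrite mulVmx// mulmx1.
  by [].
exists S0 => [|t].
  (* Both sides are the common Gram matrix [K], and cancelling the invertible [N 0] shows that [S0]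
     is symplectic. *)
  have : (N 0)^T *m (S0^T *m J *m S0) *m N 0 = (N 0)^T *m J *m N 0.
    by rewrite KN -(KM 0) -(SN 0) trmx_mul !mulmxA.
  move=> /(congr1 (mulmx^~ (invmx (N 0)))); rewrite !mulmxK//.
  move=> /(congr1 (mulmx (invmx (N 0)^T))); rewrite !mulKmx ?unitmx_tr//.
have -> : B t = S0 *m A t *m X.
  have := SN t; rewrite /N /M mul_mx_row => /eq_row_mx[<- _].
  by rewrite mulmxA.
exact: colspan_mulmx_unit.
Qed.


End CongruenceCriterion.

(** * Existence of normal frames *)

Section NormalFrameExistence.
Variables (R : realType) (n : nat).
Implicit Types A B : R -> 'M[R]_(n + n, n).
Local Notation J := (sympl_mx R n).

Lemma smooth_frameP A : fanning_frame A -> smooth (frameP A).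
Proof.
move=> [sA uA]; apply: smooth_dsubmx.
rewrite (_ : frame_coef A = fun t =>
  (-1) *: (invmx (row_mx (A t) (derive1 A t)) *m derive1n 2 A t)); last first.
  by apply/funext => t; rewrite scaleN1r.
have sA' := smooth_derive1 sA.
apply: smoothZ; apply: smooth_mulmx; last exact: smooth_derive1.
by apply: smooth_invmx; [exact: smooth_row_mx | exact: uA].
Qed.

(** The matrix (A X | (A X)') is (A | A') times a block triangular matrix with diagonal blocks X. *)
Lemma fanning_mulmx A X : fanning_frame A -> smooth X ->
  (forall t, X t \in unitmx) -> fanning_frame (fun t => A t *m X t).
Proof.
move=> [sA uA] sX uX; split=> [|t]; first exact: smooth_mulmx.
have -> : row_mx (A t *m X t) (derive1 (fun s => A s *m X s) t) =
    row_mx (A t) (derive1 A t) *m block_mx (X t) (derive1 X t) 0 (X t).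
  by rewrite mul_row_block mulmx0 addr0 derive1_mulmx// addrC.
by rewrite unitmx_mul uA unitmxE det_ublock unitrM -!unitmxE uX.
Qed.

(* Differentiating -A^T J A' and A'^T J A gives W' = -A'^T J A' and
   W' = A'^T J A' respectively. *)
Lemma wronskian_constant A : smooth A -> (forall t, lagrangian_frame (A t)) ->
  (forall t, exists Y, derive1n 2 A t = A t *m Y) ->
  forall s t, wronskian A s = wronskian A t.
Proof.
move=> sA lA A''; apply: derive0_cst_mx => t.
have sA' := smooth_derive1 sA; have [Y hY] := A'' t; have [_ iA] := lA t.
have d := smooth_is_derive t sA; have d' := smooth_is_derive t sA'.
have h1 := is_derive_mulmx (is_derive_mulmx (is_derive_trmx d')
  (is_derive_cst J t 1)) d.
have h2 := is_derive_mulmx (is_derive_mulmx (is_derive_trmx d)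
  (is_derive_cst J t 1)) d'.
rewrite -derive1n2 hY mulmx0 addr0 in h1 h2.
have z1 : (A t *m Y)^T *m J *m A t = 0.
  by rewrite trmx_mul -!mulmxA (mulmxA (A t)^T) iA mulmx0.
have z2 : (A t)^T *m J *m (A t *m Y) = 0 by rewrite mulmxA iA mul0mx.
rewrite z1 add0r in h1; rewrite z2 addr0 mulmx0 addr0 in h2.
rewrite (_ : (fun _ => _) = wronskian A) in h1; last first.
  by apply/funext => s; rewrite -wronskianE.
have h3 := is_deriveN h2.
rewrite (_ : - _ = wronskian A) in h3; last by [].
have e := is_derive1E h1; rewrite (is_derive1E h3) in e.
pose Z := (derive1 A t)^T *m J *m derive1 A t.
have /eqP : Z = - Z by exact: esym e.
rewrite -addr_eq0 -mulr2n -scaler_nat scaler_eq0 pnatr_eq0/= => /eqP Z0.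
by rewrite -/Z Z0 in h1.
Qed.

(* For A X with X' = P X / 2 the A'-component of the second derivative
   cancels; a constant change of basis then normalises the Wronskian. *)
Lemma normal_frame_exists A : fanning_frame A ->
  (forall t, lagrangian_frame (A t)) ->
  exists B, lagrangian_normal_frame B /\
    forall t, colspan (B t) = colspan (A t).
Proof.
move=> fA lA; have sA : smooth A by case: fA.
have sP := smooth_frameP fA.
have [X [sX uX dX]] := invertible_linear_ode (@smoothZ _ _ _ 2%:R^-1 _ sP).
have X' t : derive1 X t = 2%:R^-1 *: frameP A t *m X t by exact: is_derive1E.
pose B t := A t *m X t.
have sB : smooth B by exact: smooth_mulmx.
have lB t : lagrangian_frame (B t) by exact: lagrangian_mulmx.
have B'' t : derive1n 2 B t = B t *m
    (invmx (X t) *m (derive1n 2 X t - frameQ A t *m X t)).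
  rewrite mulmxA /B mulmxK// mulmxBr derive2_mulmx//.
  have AE : derive1n 2 A t = - (derive1 A t *m frameP A t) - A t *m frameQ A t.
    have [_ /(_ (conj erefl erefl)) h] :=
      frame_coefP t (frameP A t) (frameQ A t) fA.
    by move/eqP: h; rewrite -addrA addr_eq0 opprD => /eqP.
  have X'E : derive1 A t *m derive1 X t *+ 2 = derive1 A t *m frameP A t *m X t.
    rewrite X' -scalemxAl -scalemxAr -scaler_nat scalerA mulfV ?pnatr_eq0//.
    by rewrite scale1r mulmxA.
  rewrite X'E AE mulmxBl mulNmx (addrAC (- _)) addNr add0r addrC.
  by rewrite !mulmxA.
have WB := wronskian_constant sB lB (fun t => ex_intro _ _ (B'' t)).
have uW : wronskian B 0 \in unitmx.
  by apply: wronskian_unit; [exact: lB | exact: fanning_mulmx].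
have [k [Y [kn uY hY]]] := sylvester_normal_form (tr_wronskian sB lB 0) uW.
have sY : smooth (fun _ : R => Y) by exact: smooth_cst.
have BY t : colspan (B t *m Y) = colspan (A t).
  by rewrite colspan_mulmx_unit// colspan_mulmx_unit.
exists (fun t => B t *m Y); split; last exact: BY.
split.
- apply: fanning_mulmx; [exact: fanning_mulmx | exact: sY | by []].
- by move=> t; exact: lagrangian_mulmx.
- move=> t; rewrite BY -(colspan_mulmx_unit (A t) (uX t)).
  by apply/colspan_subP; rewrite derive2_mulr// B'' -mulmxA; eexists.
- by exists k; [exact: kn | move=> t; rewrite (wronskian_mulmx t sB lB sY) (WB t 0)].
Qed.

End NormalFrameExistence.

(** * From frames back to curves *)

Section Criterion.
Variables (R : realType) (n : nat).
Variables (l l' : R -> {vspace 'cV[R]_(n + n)}).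

Lemma fanning_curve_normal_frame : fanning_lagrangian_curve l ->
  exists2 A, lagrangian_normal_frame A & spans A l.
Proof.
move=> [A [fA lA Al]]; have [B [nB BA]] := normal_frame_exists fA lA.
by exists B; [exact: nB | move=> t; rewrite BA].
Qed.

Lemma spans_symplectic (S : 'M[R]_(n + n)) A : spans A l ->
  (forall t, l' t = (linfun (mulmx S : 'cV[R]_(n + n) -> 'cV[R]_(n + n)) @: l t)%VS) ->
  spans (fun t => S *m A t) l'.
Proof. by move=> Al ll' t; rewrite ll' Al limg_colspan. Qed.

(** The image S A is a normal frame of [l'] with the Wronskian and Schwarzian of A, so any normal
    frame B of [l'] can be compared with S A on the same curve. *)
Lemma congruent_normal_frames A : lagrangian_normal_frame A -> spans A l ->
  congruent l l' -> exists k, [/\ (k <= n)%N, has_signature l k,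
    has_signature l' k &
    forall B, lagrangian_normal_frame B -> spans B l' ->
    schwarzians_conjugate k A B].
Proof.
move=> nA Al [S hS ll']; have [nSA WSA QSA] := symplectic_normal hS nA.
have SAl' := spans_symplectic Al ll'.
have [_ _ _ [k kn WA]] := nA.
have lk' : has_signature l' k.
  by apply: normal_has_signature kn nSA SAl' _ => t; rewrite WSA.
exists k; split; [exact: kn | exact: normal_has_signature kn nA Al WA | exact: lk' |].
move=> B nB Bl'; have WB := normal_wronskian_signature nB Bl' lk'.
have [t|t||X oX hX] := @normal_frames_conjugate _ _ (fun t => S *m A t) B k nSA nB.
- by rewrite -Bl' -SAl'.
- by rewrite WSA.
- exact: WB.
exists X; [exact: oX | move=> t]; rewrite hX.
by rewrite (schwarzian_normal t nA) (schwarzian_normal t nSA) QSA.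
Qed.

(** The common signature makes both Wronskians equal to [Ink R n k], after which the frames
    themselves can be matched by a symplectic matrix. *)
Lemma normal_frames_criterion A B k : lagrangian_normal_frame A -> spans A l ->
  lagrangian_normal_frame B -> spans B l' -> has_signature l k ->
  has_signature l' k -> schwarzians_conjugate k A B -> congruent l l'.
Proof.
move=> nA Al nB Bl' lk lk' AB.
have WA := normal_wronskian_signature nA Al lk.
have WB := normal_wronskian_signature nB Bl' lk'.
have [S hS SAB] := normal_frames_congruent nA nB WA WB AB.
by exists S; [exact: hS | move=> t]; rewrite Bl' SAB Al limg_colspan.
Qed.

End Criterion.

Theorem theorem6p8 (R : realType) (n : nat)
    (l l' : R -> {vspace 'cV[R]_(n + n)})
    (hl : fanning_lagrangian_curve l) (hl' : fanning_lagrangian_curve l') :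
  (congruent l l' <->
     exists k : nat,
       [/\ (k <= n)%N, has_signature l k, has_signature l' k &
           forall A B : R -> 'M[R]_(n + n, n),
             lagrangian_normal_frame A -> spans A l ->
             lagrangian_normal_frame B -> spans B l' ->
             schwarzians_conjugate k A B])
  /\
  (forall A B : R -> 'M[R]_(n + n, n),
     lagrangian_normal_frame A -> spans A l ->
     lagrangian_normal_frame B -> spans B l' ->
     (congruent l l' <->
        exists k : nat,
          [/\ (k <= n)%N, has_signature l k, has_signature l' k &
              schwarzians_conjugate k A B])).
Proof.
have [A0 nA0 A0l] := fanning_curve_normal_frame hl.
have [B0 nB0 B0l'] := fanning_curve_normal_frame hl'.
split=> [|A B nA Al nB Bl']; split.
- move=> cong; have [k [kn lk lk' _]] := congruent_normal_frames nA0 A0l cong.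
  exists k; split; [exact: kn | exact: lk | exact: lk' |] => A B nA Al nB Bl'.
  (* The index [k] was obtained from [A0], and [k1] from [A]. Both are the [neg_index] of the
     Wronskian of [A] at time [0]. *)
  have [k1 [_ lk1 _ hB]] := congruent_normal_frames nA Al cong.
  have -> : k = k1; last exact: hB.
  have [[sA _] lA _ _] := nA.
  by rewrite -(lk A sA lA Al 0) (lk1 A sA lA Al 0).
- move=> [k [_ lk lk' hAB]].
  (* The existence of the normal frames [A0] and [B0] keeps the universally quantified hypothesis
     from being vacuous. *)
  exact: normal_frames_criterion nA0 A0l nB0 B0l' lk lk' (hAB _ _ nA0 A0l nB0 B0l').
- move=> cong; have [k [kn lk lk' hB]] := congruent_normal_frames nA Al cong.
  by exists k; split; [exact: kn | exact: lk | exact: lk' | exact: hB].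
- move=> [k [_ lk lk' hAB]].
  exact: normal_frames_criterion nA Al nB Bl' lk lk' hAB.
Qed.
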